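(* Let $X$ be a finite 2-dimensional simplicial complex with vertex set $S$, let $\sigma,\tau$ be complete ideal hyperbolic metrics on $X\backslash S$, and let $u\in W^{1,2}$ and $u_D\in\overline{\mathcal{D}}$ be the energy minimizing maps $(X\backslash S,\sigma)\to(X\backslash S,\tau)$ constructed as described in the context. Then $u$ and $u_D$ have degree 1.
   Context: Complexes. A finite 2-dimensional simplicial complex $X$ is a path connected quotient space $\pi:\coprod_{T\in\mathcal{C}}T\to X$, where $\mathcal{C}$ is a finite set of topological triangles (closed discs with three distinguished boundary points called vertices; the edges are the closed boundary segments between two vertices not containing the third), and the quotient identifies $x\in A$ with $f(x)\in B$ for all gluing maps $f:A\to B$ in a set $\mathcal{F}$. Here $\mathcal{F}$ consists of homeomorphisms between distinct edges of (possibly identical) triangles of $\mathcal{C}$, together with the identity of each edge; there is at most one map $A\to B$ in $\mathcal{F}$ for given edges $A,B$, and $\mathcal{F}$ is closed under inverses and compositions. Images under $\pi$ of triangles, edges and vertices are called faces, edges and vertices of $X$. Any number of faces may meet along an edge. Each edge of $X$ is oriented and gluing maps preserve orientation. $S$ denotes the set of vertices, and faces and edges of $X\backslash S$ are understood with vertices removed. Metrics. $\mathbb{H}^2=\{z=x+iy\in\mathbb{C}: y>0\}$ with $ds^2=(dx^2+dy^2)/y^2$; $\tilde T$ is the ideal hyperbolic triangle with ideal vertices $0,1,\infty$. An ideal hyperbolic metric on $X\backslash S$ consists of a diffeomorphism $\phi:T\backslash S\to\tilde T$ for each $T\in\mathcal{C}$, made an isometry by giving $T\backslash S$ the metric $\phi^*ds^2$,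 such that all gluing maps are (orientation preserving) isometries between edges; it induces a length metric on $X\backslash S$, and is called complete if this metric is complete. Maps. A map $u:(X\backslash S,\sigma)\to(X\backslash S,\tau)$ is simplicial if $u$ maps $T$ to $T$ for each face $T$ and $e$ to $e$ for each edge $e$. The energy is $E(u)=\sum_{T\in\mathcal{C}}\int_T|\nabla u|^2d\mu_\sigma$, where $|\nabla u|^2=\sum g^{\alpha\beta}h_{ij}(u)\,\partial_\alpha u^i\,\partial_\beta u^j$, with $g$ and $h$ the Riemannian metrics of $\sigma$ and $\tau$ on $T$. $W^{1,2}$ is the class of simplicial maps $u:(X\backslash S,\sigma)\to(X\backslash S,\tau)$ with $u\vert_T\in W^{1,2}(T,T)$ for every $T\in\mathcal{C}$ (so $E(u)<\infty$), and $\mathcal{D}=\{u\in W^{1,2}: u\vert_T \text{ is a diffeomorphism for all } T\in\mathcal{C}\}$ (a nonempty class). A bar denotes closure with respect to weak ($W^{1,2}$) convergence. The maps $u$ and $u_D$. Let $A$ be $W^{1,2}$ or $\mathcal{D}$. Take $w_k\in A$ with $E(w_k)\searrow\inf_{v\in A}E(v)$. Fix increasing exhaustions $X_1\subset X_2\subset\cdots$ and $X_1'\subset X_2'\subset\cdots$ of $X\backslash S$ by compact sets such that for every face $T$ the set $X_n\cap T$ (resp. $X'_n\cap T$) is convex with smooth boundary in $T$ for $\sigma$ (resp. $\tau$). For each $k$ choose $m=m(k)$ so large that $X_k$ lies in the interior of $w_k^{-1}(X'_m)$ and, for every face $T$ and $p\in X_k\cap T$, if $\phi:(T,\sigma)\to\tilde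 T$ is an isometry with $\mathrm{Re}\,\phi(p)\le\frac12$, $\mathrm{Im}\,\phi(p)\ge\frac{\sqrt3}{2}$, and $q$ is the point of $\{is: s\ge1\}$ Euclidean-closest to $\phi(p)$, then the intersection with $\tilde T$ of the Euclidean ball with center $q$ and radius $\frac{\sqrt5-1}{2}$ lies in the interior of $\phi(T\cap w_k^{-1}(X'_m))$. Let $v_k$ be an energy minimizer among maps of $\overline{A}$ equal to $w_k$ on $X\backslash w_k^{-1}(X_m')$; if $A=\mathcal{D}$, $v_k$ is taken to restrict to a harmonic diffeomorphism on the interior of $T\cap w_k^{-1}(X'_m)$ for each face $T$ (such $v_k$ exist). A subsequence of $(v_k)$ converges uniformly on compact subsets of $X\backslash S$ to a continuous map in $\overline{A}$ with energy $\inf_{v\in A}E(v)$, homotopic to any fixed $H\in\mathcal{D}$. This limit is called $u$ when $A=W^{1,2}$ and $u_D$ when $A=\mathcal{D}$. Degree. The maps $u,u_D$ are proper. Degree is the degree of a proper map, understood on each face: for each face $T$, the proper map $u\vert_T:T\to T$ of the oriented surface with boundary $T$ (vertices removed, same orientation on source and target), which maps the boundary to itself, has degree $1$. *)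

(* Defs.v *)
From HB Require Import structures.
From mathcomp Require Import all_boot all_order all_algebra.
From mathcomp Require Import all_classical all_reals all_analysis.
Set Implicit Arguments.
Unset Strict Implicit.
Unset Printing Implicit Defensive.
Import Order.TTheory GRing.Theory Num.Theory.
Import numFieldNormedType.Exports.
Local Open Scope classical_set_scope.
Local Open Scope ring_scope.

Notation plane R := (R * R)%type.

Definition coord {R : realType} (i : 'I_2) (z : plane R) : R :=
  if i == ord0 then z.1 else z.2.
Definition basis {R : realType} (i : 'I_2) : plane R :=
  if i == ord0 then (1, 0) else (0, 1).

(* The library norm of [R * R] is the sup norm. *)
Definition enorm {R : realType} (z : plane R) : R :=
  Num.sqrt (z.1 ^+ 2 + z.2 ^+ 2).

Definition unit_interval {R : realType} : set R := `[0, 1].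

Definition plane_measure (R : realType) :=
  ((@lebesgue_measure R) \x (@lebesgue_measure R))%E.

Definition rel_interior {T : topologicalType} (D A : set T) : set T :=
  [set p | D p /\ within D (nbhs p) A].
Definition rel_open {T : topologicalType} (D A : set T) : Prop :=
  D `&` A `<=` rel_interior D A.

Fixpoint Ck {R : realType} {V : normedModType R} (n : nat)
    (U : set (plane R)) (f : plane R -> V) : Prop :=
  match n with
  | 0%N => forall z, U z -> {for z, continuous f}
  | n'.+1 => (forall z, U z -> differentiable f z) /\
             (forall v : plane R, Ck n' U (fun z => 'D_v f z))
  end.

Definition smooth_open {R : realType} {V : normedModType R}
    (U : set (plane R)) (f : plane R -> V) : Prop :=
  forall n, Ck n U f.

(* Smoothness on an arbitrary subset (e.g. up to the boundary of a surface with
   boundary): local existence of smooth extensions. *)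
Definition smooth_on {R : realType}
    (A : set (plane R)) (f : plane R -> plane R) : Prop :=
  forall p, A p -> exists (U : set (plane R)) (g : plane R -> plane R),
    [/\ open U, U p, smooth_open U g & {in U `&` A, f =1 g}].

Definition diffeo_pair {R : realType}
    (A B : set (plane R)) (f g : plane R -> plane R) : Prop :=
  [/\ f @` A `<=` B, g @` B `<=` A, {in A, cancel f g} & {in B, cancel g f}] /\
  smooth_on A f /\ smooth_on B g.

Definition diffeo {R : realType}
    (A B : set (plane R)) (f : plane R -> plane R) : Prop :=
  exists g, diffeo_pair A B f g.

(* Points of the upper half-plane are pairs (x, y) with y > 0. *)
Definition ideal_tri {R : realType} : set (plane R) :=
  [set z | [/\ 0 <= z.1, z.1 <= 1, 0 < z.2 &
               (1 / 2) ^+ 2 <= (z.1 - 1 / 2) ^+ 2 + z.2 ^+ 2]].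

(* Parametrizations by t > 0 of the edges of [ideal_tri] from 0 to oo, from 1 to
   oo, and from 1 to 0. *)
Definition ideal_edge {R : realType} (i : 'I_3) (t : R) : plane R :=
  if i == 0 then (0, t)
  else if i == 1 then (1, t)
  else ((1 + t ^+ 2)^-1, t / (1 + t ^+ 2)).

Definition C1_path {R : realType} (D : set (plane R)) (g : R -> plane R)
    (z w : plane R) : Prop :=
  [/\ forall t, derivable g t 1, continuous (fun t => 'D_1 g t),
      forall t, 0 <= t <= 1 -> D (g t), g 0 = z & g 1 = w].

Definition hyp_length {R : realType} (g : R -> plane R) : R :=
  \int[lebesgue_measure]_(t in unit_interval) (enorm ('D_1 g t) / (g t).2).

(* The distance on D induced by (dx^2 + dy^2) / y^2. *)
Definition length_dist {R : realType} (D : set (plane R)) (z w : plane R) : R :=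
  inf [set l | exists2 g, C1_path D g z w & l = hyp_length g].

Definition tri_dist {R : realType} : plane R -> plane R -> R :=
  length_dist ideal_tri.

(* Segments of the uniquely geodesic space [ideal_tri] are described by equality
   in the triangle inequality. *)
Definition geod_convex {R : realType} (C : set (plane R)) : Prop :=
  forall z w p, C z -> C w -> ideal_tri p ->
    tri_dist z p + tri_dist p w = tri_dist z w -> C p.

(* The frontier is relative to [ideal_tri]: edges of the triangle contained in C
   do not count as boundary. *)
Definition smooth_boundary {R : realType} (C : set (plane R)) : Prop :=
  forall p, C p -> ~ rel_interior ideal_tri C p ->
    exists (U : set (plane R)) (rho : plane R -> R),
      [/\ open U, U p, smooth_open U rho,
          forall z, U z -> exists v, 'D_v rho z != 0 &
          C `&` U = [set z | ideal_tri z /\ U z /\ rho z <= 0]].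

Definition disc {R : realType} : set (plane R) :=
  [set z | z.1 ^+ 2 + z.2 ^+ 2 <= 1].

(* The boundary arc of the disc between a and b not containing c consists of the
   points of the circle on the line ab or on the side of it opposite to c. *)
Definition arc {R : realType} (a b c : plane R) : set (plane R) :=
  let side (p : plane R) :=
    (b.1 - a.1) * (p.2 - a.2) - (b.2 - a.2) * (p.1 - a.1) in
  [set p | p.1 ^+ 2 + p.2 ^+ 2 = 1 /\ side p * side c <= 0].

(* A topological triangle is a closed unit disc with three distinct points of the
   circle.  [(T, i)] stands for the edge of T opposite to the vertex i.  The set
   of gluing maps is given by the relation [glued A B] ("there is a map from A
   to B") and the maps [glue A B]; being closed under inverses and containing a
   unique map from an edge to itself, it makes [glue B A] the inverse of
   [glue A B], so that the gluing maps are homeomorphisms. *)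
Record triangulation (R : realType) := Triangulation {
  tri : finType;
  vtx : tri -> 'I_3 -> plane R;
  vtx_circle : forall T i, (vtx T i).1 ^+ 2 + (vtx T i).2 ^+ 2 = 1;
  vtx_inj : forall T, injective (vtx T);
  edge := fun a : tri * 'I_3 =>
    arc (vtx a.1 (a.2 + 1)) (vtx a.1 (a.2 + 2%:R)) (vtx a.1 a.2);
  glued : tri * 'I_3 -> tri * 'I_3 -> Prop;
  glued_refl : forall a, glued a a;
  glued_sym : forall a b, glued a b -> glued b a;
  glued_trans : forall a b c, glued a b -> glued b c -> glued a c;
  glue : tri * 'I_3 -> tri * 'I_3 -> plane R -> plane R;
  glue_image : forall a b, glued a b -> glue a b @` edge a `<=` edge b;
  glue_continuous : forall a b, glued a b ->
    {within edge a, continuous (glue a b)};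
  glue_id : forall a p, edge a p -> glue a a p = p;
  glue_comp : forall a b c p, glued a b -> glued b c -> edge a p ->
    glue b c (glue a b p) = glue a c p;
  (* the orientation of an edge, given by its initial vertex *)
  origin : tri * 'I_3 -> 'I_3;
  origin_edge : forall a, origin a != a.2;
  glue_oriented : forall a b, glued a b ->
    glue a b (vtx a.1 (origin a)) = vtx b.1 (origin b)
}.

(* A point (T, p) of the disjoint union of the triangles represents its class. *)
Definition point {R : realType} (K : triangulation R) : Type :=
  (tri K * plane R)%type.

(* This generates the identification; off the vertices it is already an
   equivalence relation. *)
Definition ident {R : realType} (K : triangulation R) (x y : point K) : Prop :=
  x = y \/ exists a b, [/\ glued a b, x.1 = a.1, edge a x.2 &
                           y = (b.1, glue a b x.2)].

Definition face {R : realType} (K : triangulation R) (T : tri K) :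
    set (plane R) :=
  disc `\` range (@vtx R K T).
Definition oedge {R : realType} (K : triangulation R) (a : tri K * 'I_3) :
    set (plane R) :=
  edge a `&` face a.1.

(* Open sets of the quotient of the union of the [D T] ([D T] is the disc for X,
   and [face T] for X \ S), pulled back to this union. *)
Definition quot_open {R : realType} (K : triangulation R)
    (D : tri K -> set (plane R)) (U : set (point K)) : Prop :=
  (forall x y, D x.1 x.2 -> D y.1 y.2 -> ident x y -> U x -> U y) /\
  (forall T, rel_open (D T) [set p | U (T, p)]).

(* A path in the quotient is represented by a choice of preimages of its points,
   which need not be continuous in the disjoint union. *)
Definition path_connected {R : realType} (K : triangulation R) : Prop :=
  forall x y : point K, disc x.2 -> disc y.2 ->
  exists c : R -> point K,
    [/\ c 0 = x, c 1 = y, forall t, 0 <= t <= 1 -> disc (c t).2 &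
        forall U, quot_open (fun _ : tri K => disc) U ->
          rel_open unit_interval [set t | U (c t)]].

(* [chart T] is the diffeomorphism from T \ S to the ideal triangle and
   [cochart T] its inverse.  The distance between two points of an edge is their
   distance along the edge. *)
Record ideal_metric (R : realType) (K : triangulation R) := IdealMetric {
  chart : tri K -> plane R -> plane R;
  cochart : tri K -> plane R -> plane R;
  chart_diffeo : forall T,
    diffeo_pair (face T) ideal_tri (chart T) (cochart T);
  edge_dist := fun (a : tri K * 'I_3) p q =>
    length_dist (chart a.1 @` oedge a) (chart a.1 p) (chart a.1 q);
  glue_isometry : forall a b, glued a b -> forall p q, oedge a p -> oedge a q ->
    edge_dist b (glue a b p) (glue a b q) = edge_dist a p q
}.

(* [joined s x y l]: a path of length l joins x and y in X \ S, where a path is a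
   finite concatenation of C^1 paths, each in one face. *)
Inductive joined {R : realType} (K : triangulation R) (s : ideal_metric K) :
    point K -> point K -> R -> Prop :=
| joined_path T p q g of face T p & face T q
    & C1_path ideal_tri g (chart s T p) (chart s T q) :
    joined s (T, p) (T, q) (hyp_length g)
| joined_ident x y of face x.1 x.2 & face y.1 y.2 & ident x y : joined s x y 0
| joined_trans x y z l l' of joined s x y l & joined s y z l' :
    joined s x z (l + l').

Definition metric_dist {R : realType} (K : triangulation R) (s : ideal_metric K)
    (x y : point K) : \bar R :=
  ereal_inf [set l%:E | l in [set l | joined s x y l]].

Definition complete_metric {R : realType} (K : triangulation R)
    (s : ideal_metric K) : Prop :=
  forall x : nat -> point K,
    (forall n, face (x n).1 (x n).2) ->
    (forall e : R, 0 < e -> exists N, forall m n, (N <= m)%N -> (N <= n)%N ->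
       (metric_dist s (x m) (x n) < e%:E)%E) ->
    exists y : point K, face y.1 y.2 /\
      forall e : R, 0 < e -> exists N, forall n, (N <= n)%N ->
        (metric_dist s (x n) y < e%:E)%E.

Definition test_function {R : realType} (U : set (plane R))
    (eta : plane R -> R) : Prop :=
  smooth_open setT eta /\
  exists K : set (plane R), [/\ compact K, K `<=` U &
                                forall z, ~ K z -> eta z = 0].

Definition loc_integrable {R : realType} (U : set (plane R))
    (f : plane R -> R) : Prop :=
  forall K : set (plane R), compact K -> K `<=` U ->
    (@plane_measure R).-integrable K (EFin \o f).

Definition weak_partial {R : realType} (U : set (plane R)) (i : 'I_2)
    (f g : plane R -> R) : Prop :=
  [/\ loc_integrable U f, loc_integrable U g &
      forall eta, test_function U eta ->
        \int[@plane_measure R]_(z in U) (f z * 'D_(basis i) eta z) =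
        - \int[@plane_measure R]_(z in U) (g z * eta z)].

(* [G i a] is the derivative in the direction a of the i-th coordinate. *)
Definition weak_jacobian {R : realType} (f : plane R -> plane R)
    (G : 'I_2 -> 'I_2 -> plane R -> R) : Prop :=
  forall i a, weak_partial ideal_tri^° a (coord i \o f) (G i a).

Definition hyp_metric {R : realType} (z : plane R) (i j : 'I_2) : R :=
  (i == j)%:R / z.2 ^+ 2.
Definition hyp_inverse_metric {R : realType} (z : plane R) (i j : 'I_2) : R :=
  (i == j)%:R * z.2 ^+ 2.

Definition energy_density {R : realType} (f : plane R -> plane R)
    (G : 'I_2 -> 'I_2 -> plane R -> R) (z : plane R) : R :=
  \sum_(a < 2) \sum_(b < 2) \sum_(i < 2) \sum_(j < 2)
    hyp_inverse_metric z a b * hyp_metric (f z) i j * G i a z * G j b z.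

(* The hyperbolic area is dx dy / y^2. *)
Definition hyp_integral {R : realType} (F : plane R -> R) : \bar R :=
  (\int[@plane_measure R]_(z in ideal_tri) (F z / z.2 ^+ 2)%:E)%E.

(* Weak derivatives being unique almost everywhere, this is an infimum over at
   most one value; it is +oo when f has no weak derivatives. *)
Definition tri_energy {R : realType} (f : plane R -> plane R) : \bar R :=
  ereal_inf [set hyp_integral (energy_density f G) | G in weak_jacobian f].

(* The square of the L^2 norm; the choice of the base point is immaterial since
   the ideal triangle has finite area. *)
Definition tri_L2 {R : realType} (f : plane R -> plane R) : \bar R :=
  hyp_integral (fun z => tri_dist (f z) (1 / 2, 1) ^+ 2).

Definition sobolev {R : realType} (f : plane R -> plane R) : Prop :=
  (tri_energy f < +oo)%E /\ (tri_L2 f < +oo)%E.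

Definition half_disc {R : realType} (p : plane R) (r : R) : set (plane R) :=
  [set z | ideal_tri z /\ enorm (z - p) < r].

(* f p is the value at the boundary point p of the trace of f: the mean of the
   distance to f p over small half-discs at p tends to 0 (their area is of the
   order of r^2). *)
Definition trace_at {R : realType} (f : plane R -> plane R) (p : plane R) : Prop :=
  (fun r : R =>
     (\int[@plane_measure R]_(z in half_disc p r) (tri_dist (f z) (f p))%:E)
     * (r ^- 2)%:E)%E @ 0^'+ --> 0%E.

Definition has_trace {R : realType} (f : plane R -> plane R) : Prop :=
  forall i : 'I_3,
    {ae (@lebesgue_measure R), forall t, 0 < t -> trace_at f (ideal_edge i t)}.

(* Boundedness in W^{1,2} and convergence against test functions; by definition
   of the weak derivatives these then converge against test functions too. *)
Definition tri_weak_cvg {R : realType} (fk : nat -> plane R -> plane R)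
    (f : plane R -> plane R) : Prop :=
  (exists M : R, forall k, (tri_energy (fk k) + tri_L2 (fk k) <= M%:E)%E) /\
  (forall (i : 'I_2) eta, test_function ideal_tri^° eta ->
     (fun k => \int[@plane_measure R]_(z in ideal_tri^°)
                  (coord i (fk k z) * eta z)) @ \oo -->
     \int[@plane_measure R]_(z in ideal_tri^°) (coord i (f z) * eta z)).

(* A map of X \ S preserving every face is given by its restrictions to faces. *)
Definition smap {R : realType} (K : triangulation R) : Type :=
  tri K -> plane R -> plane R.

Definition simplicial {R : realType} (K : triangulation R) (u : smap K) : Prop :=
  [/\ forall T, u T @` face T `<=` face T,
      forall a, u a.1 @` oedge a `<=` oedge a &
      forall a b p, glued a b -> oedge a p ->
        u b.1 (glue a b p) = glue a b (u a.1 p)].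

Definition in_charts {R : realType} (K : triangulation R) (s t : ideal_metric K)
    (u : smap K) (T : tri K) : plane R -> plane R :=
  chart t T \o u T \o cochart s T.

Definition energy {R : realType} (K : triangulation R) (s t : ideal_metric K)
    (u : smap K) : \bar R :=
  (\sum_(T : tri K) tri_energy (in_charts s t u T))%E.

(* Sobolev maps are represented by functions whose values on the edges are their
   traces, so that the simplicial condition on edges is meaningful. *)
Definition W12 {R : realType} (K : triangulation R) (s t : ideal_metric K) :
    set (smap K) :=
  [set u | simplicial u /\
     forall T, sobolev (in_charts s t u T) /\ has_trace (in_charts s t u T)].

Definition diffeo_class {R : realType} (K : triangulation R)
    (s t : ideal_metric K) : set (smap K) :=
  [set u | W12 s t u /\ forall T, diffeo (face T) (face T) (u T)].

Definition weak_closure {R : realType} (K : triangulation R)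
    (s t : ideal_metric K) (A : set (smap K)) : set (smap K) :=
  [set u | W12 s t u /\ exists uk : nat -> smap K, (forall k, A (uk k)) /\
     forall T, tri_weak_cvg (fun k => in_charts s t (uk k) T)
                            (in_charts s t u T)].

(* Homotopy of maps X \ S -> X \ S; as for paths, continuity is that of the map
   induced on the quotient. *)
Definition homotopic {R : realType} (K : triangulation R) (u v : smap K) : Prop :=
  exists h : R -> point K -> point K,
    [/\ forall t x, 0 <= t <= 1 -> face x.1 x.2 -> face (h t x).1 (h t x).2,
        forall t x y, 0 <= t <= 1 -> face x.1 x.2 -> face y.1 y.2 ->
          ident x y -> ident (h t x) (h t y),
        forall T p, face T p ->
          ident (h 0 (T, p)) (T, u T p) /\ ident (h 1 (T, p)) (T, v T p) &
        forall U, quot_open (@face R K) U -> forall T,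
          rel_open (unit_interval `*` face T)
                   [set tp : R * plane R | U (h tp.1 (T, tp.2))]].

(* Christoffel symbols of the half-plane, i.e. of the conformal metric
   e^(2 lambda) (dx^2 + dy^2) with lambda = - ln y. *)
Definition christoffel {R : realType} (k i j : 'I_2) (z : plane R) : R :=
  (((i == j) && (k == ord_max))%:R - ((k == i) && (j == ord_max))%:R
   - ((k == j) && (i == ord_max))%:R) / z.2.

Definition tension {R : realType} (f : plane R -> plane R) (k : 'I_2)
    (z : plane R) : R :=
  let d (a : 'I_2) (i : 'I_2) := 'D_(basis a) (coord i \o f) in
  \sum_(a < 2) \sum_(b < 2) hyp_inverse_metric z a b *
    ('D_(basis a) (d b k) z
     - \sum_(c < 2) christoffel c a b z * d c k z
     + \sum_(i < 2) \sum_(j < 2) christoffel k i j (f z) * d a i z * d b j z).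

(* Meant for U open in the plane, so that derivatives in U are two-sided. *)
Definition harmonic_diffeo {R : realType} (K : triangulation R)
    (s t : ideal_metric K) (u : smap K) (T : tri K) (U : set (plane R)) : Prop :=
  diffeo U (u T @` U) (u T) /\
  forall k z, (chart s T @` U) z -> tension (in_charts s t u T) k z = 0.

Record convex_exhaustion {R : realType} (K : triangulation R)
    (s : ideal_metric K) (X : nat -> tri K -> set (plane R)) : Prop := {
  exh_face : forall n T, X n T `<=` face T;
  (* X n is a subset of the quotient *)
  exh_ident : forall n x y, face x.1 x.2 -> face y.1 y.2 -> ident x y ->
    X n x.1 x.2 -> X n y.1 y.2;
  exh_compact : forall n T, compact (X n T);
  exh_mono : forall n T, X n T `<=` X n.+1 T;
  exh_cover : forall T p, face T p -> exists n, X n T p;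
  exh_convex : forall n T, geod_convex (chart s T @` X n T);
  exh_smooth : forall n T, smooth_boundary (chart s T @` X n T)
}.

Definition preimg {R : realType} (K : triangulation R) (w : smap K)
    (X : tri K -> set (plane R)) (T : tri K) : set (plane R) :=
  [set p | face T p /\ X T (w T p)].

Definition face_isometry {R : realType} (K : triangulation R)
    (s : ideal_metric K) (T : tri K) (phi : plane R -> plane R) : Prop :=
  phi @` face T = ideal_tri /\
  forall p q, face T p -> face T q ->
    tri_dist (phi p) (phi q) = tri_dist (chart s T p) (chart s T q).

(* The points q with q.1 = 0, 1 <= q.2 and minimality of the distance to phi p
   are the Euclidean projections of phi p to {is : s >= 1}. *)
Definition large_enough {R : realType} (K : triangulation R)
    (s : ideal_metric K) (w : smap K) (X X' : tri K -> set (plane R)) : Prop :=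
  (forall T, X T `<=` rel_interior (face T) (preimg w X' T)) /\
  (forall T p phi (q : plane R), X T p -> face_isometry s T phi ->
     (phi p).1 <= 1 / 2 -> Num.sqrt 3 / 2 <= (phi p).2 ->
     q.1 = 0 -> 1 <= q.2 ->
     (forall r : R, 1 <= r -> enorm (phi p - q) <= enorm (phi p - (0, r))) ->
     forall z, ideal_tri z -> enorm (z - q) < (Num.sqrt 5 - 1) / 2 ->
       rel_interior ideal_tri (phi @` preimg w X' T) z).

Definition agree_off {R : realType} (K : triangulation R)
    (Y : tri K -> set (plane R)) (v w : smap K) : Prop :=
  forall T p, face T p -> ~ Y T p -> v T p = w T p.

Definition admissible {R : realType} (K : triangulation R)
    (s t : ideal_metric K) (diff : bool) : set (smap K) :=
  if diff then diffeo_class s t else W12 s t.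

(* [diff] tells whether the class A is the class of diffeomorphisms or W^{1,2};
   [j] extracts the convergent subsequence of (v_k).  The last four fields are the
   known properties of its limit u. *)
Record minimizing_construction {R : realType} (K : triangulation R)
    (s t : ideal_metric K) (diff : bool) (w v : nat -> smap K)
    (X X' : nat -> tri K -> set (plane R)) (m j : nat -> nat) (u : smap K) :
    Prop := {
  w_in : forall k, admissible s t diff (w k);
  w_nonincr : forall k, (energy s t (w k.+1) <= energy s t (w k))%E;
  w_minimizing : (fun k => energy s t (w k)) @ \oo -->
    ereal_inf (energy s t @` admissible s t diff);
  X_exhaustion : convex_exhaustion s X;
  X'_exhaustion : convex_exhaustion t X';
  m_large : forall k, large_enough s (w k) (X k) (X' (m k));
  v_in : forall k, weak_closure s t (admissible s t diff) (v k);
  v_agree : forall k, agree_off (preimg (w k) (X' (m k))) (v k) (w k);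
  v_minimizer : forall k f, weak_closure s t (admissible s t diff) f ->
    agree_off (preimg (w k) (X' (m k))) f (w k) ->
    (energy s t (v k) <= energy s t f)%E;
  v_harmonic : diff -> forall k T,
    harmonic_diffeo s t (v k) T (preimg (w k) (X' (m k)) T)^°;
  j_incr : forall k, (j k < j k.+1)%N;
  u_limit : forall T (C : set (plane R)), compact C -> C `<=` face T ->
    forall e : R, 0 < e -> exists N, forall k, (N <= k)%N -> forall p, C p ->
      tri_dist (chart t T (v (j k) T p)) (chart t T (u T p)) < e;
  u_continuous : forall T, {within face T, continuous (u T)};
  u_closure : weak_closure s t (admissible s t diff) u;
  u_energy : energy s t u = ereal_inf (energy s t @` admissible s t diff);
  u_homotopic : forall H, diffeo_class s t H -> homotopic u H
}.

Definition constructed_minimizer {R : realType} (K : triangulation R)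
    (s t : ideal_metric K) (diff : bool) (u : smap K) : Prop :=
  exists w v X X' m j, minimizing_construction s t diff w v X X' m j u.

Definition proper_on {R : realType} (A B : set (plane R))
    (f : plane R -> plane R) : Prop :=
  forall C : set (plane R), compact C -> C `<=` B ->
    compact [set p | A p /\ C (f p)].

Definition face_boundary {R : realType} (K : triangulation R) (T : tri K) :
    set (plane R) :=
  [set p | face T p /\ p.1 ^+ 2 + p.2 ^+ 2 = 1].

Definition proper_homotopic {R : realType} (K : triangulation R) (T : tri K)
    (f g : plane R -> plane R) : Prop :=
  exists h : R * plane R -> plane R,
    [/\ {within unit_interval `*` face T, continuous h},
        forall t p, 0 <= t <= 1 -> face T p -> face T (h (t, p)),
        forall t p, 0 <= t <= 1 -> face_boundary T p -> face_boundary T (h (t, p)),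
        forall p, face T p -> h (0, p) = f p /\ h (1, p) = g p &
        forall C : set (plane R), compact C -> C `<=` face T ->
          compact [set x | (unit_interval `*` face T) x /\ C (h x)]].

Definition jacobian_det {R : realType} (g : plane R -> plane R) (p : plane R) : R :=
  let d i := 'D_(basis i) g p in
  (d ord0).1 * (d ord_max).2 - (d ord_max).1 * (d ord0).2.

(* The degree of a proper map of pairs f is the number of preimages, counted with
   orientation signs, of a regular value in the interior under a smooth map
   properly homotopic to f; the classical theorem is that this number does not
   depend on the smooth map nor on the regular value.  The orientation of T is
   that of the plane. *)
Definition has_degree {R : realType} (K : triangulation R) (T : tri K)
    (f : plane R -> plane R) (d : int) : Prop :=
  exists (g : plane R -> plane R) (y : plane R) (xs : seq (plane R)),
    [/\ proper_homotopic T f g, smooth_on (face T) g,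
        face T y /\ ~ face_boundary T y &
        [/\ uniq xs, forall x, (x \in xs) <-> (face T x /\ g x = y),
            {in xs, forall x, jacobian_det g x != 0} &
            d = \sum_(x <- xs) sgz (jacobian_det g x)]].

(* Main.v *)
Require Import Defs.
From mathcomp Require Import all_boot all_order all_algebra.
From mathcomp Require Import all_classical all_reals all_analysis.
From mathcomp Require Import ring lra.

(** Both maps are continuous, proper, and send each face and each edge to itself.
    This forces degree 1, because such a map of a face T is properly homotopic,
    through maps preserving the boundary, to the identity, which has exactly one,
    positive, preimage of an interior point.

    The homotopy is built in the ideal triangle, onto which a chart of the metric
    maps T.  In the coordinates x and s = x^2 + y^2 geodesics are straight and the
    ideal triangle becomes the convex region 0 <= x <= 1, s >= x without the
    points (0, 0) and (1, 1), so that the straight-line homotopy (the map [mix])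
    makes sense; it preserves the three sides since they are convex
    ([mix_convex_form_eq0]).

    Its properness ([mix_proper]) is a statement about the three ends.  Each has
    arbitrarily small convex connected neighbourhoods, and properness of the map
    sends a small one into a neighbourhood of some end.  This is the same end,
    because an end is determined by the two sides adjacent to it, which are
    preserved ([cusp_preserved]).  By convexity the homotopy stays near the end.

    It remains to see that the map preserves the sides of the ideal triangle,
    knowing that it preserves the arcs of the disc T ([chart_conj_side]).  A chart
    exchanges boundary points: at a boundary point corresponding to an interior
    one, a function defining the boundary would have zero differential
    ([diffeo_interior_critical]).  Connectedness then sends each side into a single
    arc, and a counting argument makes this correspondence bijective. *)

Set Implicit Arguments.
Unset Strict Implicit.
Unset Printing Implicit Defensive.
Import Order.TTheory GRing.Theory Num.Theory.
Import numFieldNormedType.Exports.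
Local Open Scope classical_set_scope.
Local Open Scope ring_scope.

(** * Continuity and connectedness *)

Lemma within_continuous_comp (T U V : topologicalType) (A : set T) (B : set U)
    (f : T -> U) (g : U -> V) :
  {within A, continuous f} -> {within B, continuous g} -> f @` A `<=` B ->
  {within A, continuous (g \o f)}.
Proof.
move=> /subspace_continuousP cf /subspace_continuousP cg fAB.
apply/subspace_continuousP => x Ax.
have Bfx : B (f x) by apply: fAB; exists x.
apply: (cvg_comp f g _ (cg _ Bfx)) => W nW.
have nW' : within A (nbhs x) (f @^-1` [set y | B y -> W y]) by exact: cf.
have nA : within A (nbhs x) A by exact: withinT.
change (within A (nbhs x) (f @^-1` W)).
apply: filterS2 nA nW' => z Az; apply; apply: fAB; exists z => //.
Qed.

Lemma within_continuous_pair (T U V : topologicalType) (A : set T)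
    (f : T -> U) (g : T -> V) :
  {within A, continuous f} -> {within A, continuous g} ->
  {within A, continuous (fun x => (f x, g x))}.
Proof.
by move=> cf cg x; apply: cvg_pair; [exact: cf|exact: cg].
Qed.

Lemma pair_continuous (T U V : topologicalType) (f : T -> U) (g : T -> V) :
  continuous f -> continuous g -> continuous (fun x => (f x, g x)).
Proof. by move=> cf cg x; apply: cvg_pair; [exact: cf|exact: cg]. Qed.

Lemma compact_within_preimage (T U : topologicalType) (Q : set T) (C : set U)
    (f : T -> U) :
  compact Q -> {within Q, continuous f} -> closed C ->
  compact (Q `&` f @^-1` C).
Proof.
move=> cQ /continuous_closedP cf /cf /closed_subspaceP [V cV VQ].
rewrite setIC -VQ setIC; exact: compact_closedI.
Qed.

(** On S every F i is clopen: its complement in S is the union of the others.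
    This is used with open cusps and with closed arcs of the circle. *)
Lemma connected_pigeonhole (T : topologicalType) (I : finType) (F : I -> set T)
    (S : set T) :
  connected S -> S !=set0 ->
  (forall i, open (F i)) \/ (forall i, closed (F i)) ->
  (forall x, S x -> exists i, F i x) ->
  (forall i j x, S x -> F i x -> F j x -> i = j) -> exists i, S `<=` F i.
Proof.
move=> cS [x0 Sx0] oc cov dis; have [i Fi0] := cov _ Sx0; exists i.
pose G := \bigcup_(k in [set k | k != i]) F k.
have SG : S `&` F i = S `&` ~` G.
  apply/seteqP; split => x [Sx Fx]; split => //.
    by move=> [k /= /eqP ki Fk]; apply: ki; apply: (dis k i x).
  have [k Fk] := cov _ Sx; have [->//|ki] := pselect (i = k).
  by exfalso; apply: Fx; exists k => //=; apply/eqP => e; apply: ki.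
suff SF : S `&` F i = S by rewrite -SF => x [].
apply: cS; first by exists x0.
- case: oc => oc; first by exists (F i).
  exists (~` G) => //; apply: closed_openC.
  by apply: closed_bigcup => //; exact: finite_finset.
- case: oc => oc; last by exists (F i).
  exists (~` G) => //; apply: open_closedC; exact: bigcup_open.
Qed.

(** * Convexity of the ideal triangle in projective coordinates *)

(** The affine functions of (x, s) with s = x^2 + y^2, the coordinates in which
    the geodesics of the half-plane, zero sets of forms, are straight lines. *)
Definition form {R : realType} (c : R * R * R) (z : plane R) : R :=
  c.1.1 + c.1.2 * z.1 + c.2 * (z.1 ^+ 2 + z.2 ^+ 2).

(** The convex combination of z and w in the coordinates (x, s), read back in the
    half-plane through y = sqrt (s - x^2). *)
Definition mix {R : realType} (t : R) (z w : plane R) : plane R :=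
  let x := (1 - t) * z.1 + t * w.1 in
  (x, Num.sqrt ((1 - t) * (z.1 ^+ 2 + z.2 ^+ 2)
                + t * (w.1 ^+ 2 + w.2 ^+ 2) - x ^+ 2)).

Definition mix_convex {R : realType} (S : set (plane R)) : Prop :=
  forall t z w, 0 <= t <= 1 -> S z -> S w -> S (mix t z w).

(** The coefficients of x, 1 - x and s - x: the ideal triangle is where they are
    nonnegative, and its three sides are their zero sets. *)
Definition wall {R : realType} (i : 'I_3) : R * R * R :=
  if i == 0 then (0, 1, 0) else if i == 1 then (1, - 1, 0) else (0, - 1, 1).

(** The negative set of [cusp e i] is a neighbourhood of the ideal vertex opposite
    to the side i: 1 for i = 0, 0 for i = 1 and oo for i = 2.  The first two say
    that the sum of the walls meeting at the vertex is less than e, the last one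
    that s > 1 / e. *)
Definition cusp {R : realType} (e : R) (i : 'I_3) : R * R * R :=
  if i == 0 then (1 - e, - 2, 1) else if i == 1 then (- e, 0, 1)
  else (1, 0, - e).

Lemma ord3P (P : 'I_3 -> Prop) : P 0 -> P 1 -> P 2%:R -> forall i, P i.
Proof.
move=> P0 P1 P2 [[|[|[|//]]] h].
- by rewrite (_ : Ordinal h = 0) //; apply/val_inj.
- by rewrite (_ : Ordinal h = 1) //; apply/val_inj.
- by rewrite (_ : Ordinal h = 2%:R) //; apply/val_inj.
Qed.

Section ContinuousArithmetic.
Context {R : realType} {T : topologicalType}.
Implicit Types f g : T -> R.

Lemma continuous_add f g :
  continuous f -> continuous g -> continuous (fun x => f x + g x).
Proof. by move=> cf cg p; apply: cvgD; [exact: cf|exact: cg]. Qed.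

Lemma continuous_mul f g :
  continuous f -> continuous g -> continuous (fun x => f x * g x).
Proof. by move=> cf cg p; apply: cvgM; [exact: cf|exact: cg]. Qed.

Lemma continuous_sqr f : continuous f -> continuous (fun x => f x ^+ 2).
Proof.
move=> cf p; apply: (@continuous_comp _ _ _ f (fun r => r ^+ 2) p (cf p)).
exact: exprn_continuous.
Qed.

End ContinuousArithmetic.

Section Mix.
Variable R : realType.
Implicit Types (z w : plane R) (t e : R) (S : set (plane R)).

(** The height of a convex combination is a genuine square root: the right-hand
    side shows that it is positive when z and w lie in the half-plane. *)
Lemma mix_height t z w :
  (1 - t) * (z.1 ^+ 2 + z.2 ^+ 2) + t * (w.1 ^+ 2 + w.2 ^+ 2)
    - ((1 - t) * z.1 + t * w.1) ^+ 2 =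
  (1 - t) * z.2 ^+ 2 + t * w.2 ^+ 2 + t * (1 - t) * (z.1 - w.1) ^+ 2.
Proof. ring. Qed.

Lemma form_mix c t z w : 0 <= t <= 1 ->
  form c (mix t z w) = (1 - t) * form c z + t * form c w.
Proof.
move=> /andP[t0 t1]; rewrite /form /mix /= sqr_sqrtr; last first.
  rewrite mix_height; have t1' : 0 <= 1 - t by rewrite subr_ge0.
  by rewrite !addr_ge0 // mulr_ge0 ?sqr_ge0 // mulr_ge0.
ring.
Qed.

Lemma mix_gt0 t z w : 0 <= t <= 1 -> 0 < z.2 -> 0 < w.2 -> 0 < (mix t z w).2.
Proof.
move=> /andP[t0 t1] z0 w0; rewrite /mix /= sqrtr_gt0 mix_height.
have t1' : 0 <= 1 - t by rewrite subr_ge0.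
apply: ltr_wpDr; first by rewrite mulr_ge0 ?sqr_ge0 // mulr_ge0.
have z2 : 0 < z.2 ^+ 2 by rewrite exprn_gt0.
have w2 : 0 < w.2 ^+ 2 by rewrite exprn_gt0.
have [->|tn0] := eqVneq t 0; first by rewrite subr0 mul1r mul0r addr0.
have tp : 0 < t by rewrite lt0r tn0.
by rewrite ltr_wpDl ?mulr_gt0 // mulr_ge0 // ltW.
Qed.

Lemma mix0 z w : 0 <= z.2 -> mix 0 z w = z.
Proof.
move=> z0; case: z z0 => x y /= y0; rewrite /mix /= subr0 !mul1r !mul0r !addr0.
by rewrite addrAC subrr add0r sqrtr_sqr ger0_norm.
Qed.

Lemma mix1 z w : 0 <= w.2 -> mix 1 z w = w.
Proof.
move=> w0; case: w w0 => x y /= y0; rewrite /mix /= subrr !mul1r !mul0r !add0r.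
by rewrite addrAC subrr add0r sqrtr_sqr ger0_norm.
Qed.

Lemma mix_continuous :
  continuous (fun x : R * (plane R * plane R) => mix x.1 x.2.1 x.2.2).
Proof.
pose D := (R * (plane R * plane R))%type.
have ct : continuous (fun x : D => x.1) by move=> p; exact: cvg_fst.
have c2 : continuous (fun x : D => x.2) by move=> p; exact: cvg_snd.
have c21 : continuous (fun x : D => x.2.1).
  by move=> p; apply: (continuous_comp (c2 p)); exact: cvg_fst.
have c22 : continuous (fun x : D => x.2.2).
  by move=> p; apply: (continuous_comp (c2 p)); exact: cvg_snd.
have a1 : continuous (fun x : D => x.2.1.1).
  by move=> p; apply: (continuous_comp (c21 p)); exact: cvg_fst.
have a2 : continuous (fun x : D => x.2.1.2).
  by move=> p; apply: (continuous_comp (c21 p)); exact: cvg_snd.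
have b1 : continuous (fun x : D => x.2.2.1).
  by move=> p; apply: (continuous_comp (c22 p)); exact: cvg_fst.
have b2 : continuous (fun x : D => x.2.2.2).
  by move=> p; apply: (continuous_comp (c22 p)); exact: cvg_snd.
have c1t : continuous (fun x : D => 1 - x.1).
  by move=> p; apply: cvgB (ct p); exact: cvg_cst.
have cm (f g : D -> R) : continuous f -> continuous g ->
    continuous (fun x : D => (1 - x.1) * f x + x.1 * g x).
  by move=> cf cg; apply: continuous_add; apply: continuous_mul.
have cn (f g : D -> R) : continuous f -> continuous g ->
    continuous (fun x : D => f x ^+ 2 + g x ^+ 2).
  by move=> cf cg; apply: continuous_add; apply: continuous_sqr.
have cx := cm _ _ a1 b1.
have cs := cm _ _ (cn _ _ a1 a2) (cn _ _ b1 b2).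
apply: pair_continuous; first exact: cx.
move=> p; apply: (@continuous_comp _ _ _ (fun x : D =>
    (1 - x.1) * (x.2.1.1 ^+ 2 + x.2.1.2 ^+ 2)
    + x.1 * (x.2.2.1 ^+ 2 + x.2.2.2 ^+ 2)
    - ((1 - x.1) * x.2.1.1 + x.1 * x.2.2.1) ^+ 2) (@Num.sqrt R) p);
  last exact: sqrt_continuous.
by apply: cvgB; [exact: cs|exact: (continuous_sqr cx)].
Qed.

(** Every point is joined to a fixed one by the path of their combinations. *)
Lemma mix_convex_connected S :
  (forall z, S z -> 0 <= z.2) -> mix_convex S -> connected S.
Proof.
move=> S0 cS; have [->|/set0P [z Sz]] := eqVneq S set0; first exact: connected0.
have -> : S = \bigcup_(w in S) ((fun t => mix t z w) @` `[0, 1]).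
  apply/seteqP; split => [w Sw|_ [w Sw [t /= t01 <-]]].
    exists w => //; exists 1; last by rewrite mix1 // S0.
    by rewrite /= in_itv /= ler01 lexx.
  by apply: cS => //; move: t01; rewrite in_itv.
apply: bigcup_connected.
  exists z => w Sw; exists 0; last by rewrite mix0 // S0.
  by rewrite /= in_itv /= ler01 lexx.
move=> w Sw; apply: connected_continuous_connected.
  exact: segment_connected.
apply: continuous_subspaceT => t.
have ct : continuous (fun t : R => (t, (z, w))).
  by apply: pair_continuous => s; [exact: cvg_id|exact: cvg_cst].
exact: (continuous_comp (ct t) (@mix_continuous _)).
Qed.

Lemma ideal_triP z :
  ideal_tri z <-> 0 < z.2 /\ forall i, 0 <= form (wall i) z.
Proof.
split=> [[x0 x1 y0 h]|[y0 h]].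
  split=> //; apply: ord3P; rewrite /form /wall /=; nra.
have := h 0; have := h 1; have := h 2%:R; rewrite /form /wall /= => h2 h1 h0.
split=> //; nra.
Qed.

Lemma form_continuous c : continuous (@form R c).
Proof.
have c1 : continuous (fun x : plane R => x.1) by move=> p; exact: cvg_fst.
have c2 : continuous (fun x : plane R => x.2) by move=> p; exact: cvg_snd.
have ck (k : R) : continuous (fun _ : plane R => k) by move=> p; exact: cvg_cst.
apply: continuous_add.
  by apply: continuous_add => //; apply: continuous_mul.
by apply: continuous_mul => //; apply: continuous_add; apply: continuous_sqr.
Qed.

Lemma closed_form_ge0 c : closed [set z : plane R | 0 <= form c z].
Proof.
have /continuous_closedP := @form_continuous c.
by move=> /(_ [set x : R | 0 <= x]); apply; exact: closed_ge.
Qed.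

Lemma open_form_lt0 c : open [set z : plane R | form c z < 0].
Proof.
have -> : [set z : plane R | form c z < 0] = ~` [set z : plane R | 0 <= form c z].
  by apply/seteqP; split=> z /=; rewrite ltNge => /negP.
exact/closed_openC/closed_form_ge0.
Qed.

Lemma mix_convex_ideal_tri : mix_convex (@ideal_tri R).
Proof.
move=> t z w t01 /ideal_triP[z0 hz] /ideal_triP[w0 hw]; apply/ideal_triP.
split; first exact: mix_gt0.
move=> i; rewrite form_mix //; case/andP: t01 => t0 t1.
by rewrite addr_ge0 // mulr_ge0 // subr_ge0.
Qed.

Lemma mix_convex_form_eq0 c :
  mix_convex (@ideal_tri R `&` [set z | form c z = 0]).
Proof.
move=> t z w t01 [tz /= hz] [tw /= hw]; split; first exact: mix_convex_ideal_tri.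
by rewrite /= form_mix // hz hw !mulr0 addr0.
Qed.

Lemma mix_convex_form_lt0 c :
  mix_convex (@ideal_tri R `&` [set z | form c z < 0]).
Proof.
move=> t z w t01 [tz /= hz] [tw /= hw]; split; first exact: mix_convex_ideal_tri.
rewrite /= form_mix //; case/andP: t01 => t0 t1.
nra.
Qed.

End Mix.

(** * Cusps of the ideal triangle *)

Section Cusps.
Variable R : realType.
Implicit Types (z : plane R) (d e : R) (i j : 'I_3).

Definition side i : set (plane R) :=
  ideal_tri `&` [set z | form (wall i) z = 0].

Definition cusp_nbhd e i : set (plane R) :=
  ideal_tri `&` [set z | form (cusp e i) z < 0].

Definition core e : set (plane R) :=
  ideal_tri `&` [set z | forall i, 0 <= form (cusp e i) z].

Lemma cusp_disjoint e z i j : 0 < e <= 1 / 2 ->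
  cusp_nbhd e i z -> cusp_nbhd e j z -> i = j.
Proof.
move=> /andP[e0 e1] [/ideal_triP[z0 h] /= zi] [_ /= zj].
have := h 0; have := h 1; have := h 2%:R => {h}.
move: i j zi zj.
apply: ord3P; apply: ord3P => //; rewrite /form /wall /cusp /= => *;
  exfalso; nra.
Qed.

Lemma cusp_nbhdS d e i : d <= e -> cusp_nbhd d i `<=` cusp_nbhd e i.
Proof.
move=> de z [tz /= zi]; split=> //=; move: zi.
have : 0 <= z.1 ^+ 2 + z.2 ^+ 2 by rewrite addr_ge0 // sqr_ge0.
move: i; apply: ord3P; rewrite /form /cusp /= => *; nra.
Qed.

(** With [cusp_side_meet]: a cusp is adjacent to the two sides ending at its ideal
    vertex and to no other, hence is determined by the sides that it meets. *)
Lemma cusp_side_disjoint e z i : 0 < e <= 1 / 2 ->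
  cusp_nbhd e i z -> ~ side i z.
Proof.
move=> /andP[e0 e1] [/ideal_triP[z0 h] /= zi] [_ /=].
have := h 0; have := h 1; have := h 2%:R => {h}.
move: i zi.
apply: ord3P; rewrite /form /wall /cusp /= => *; nra.
Qed.

Lemma cusp_side_meet e i j : 0 < e <= 1 / 2 -> i != j ->
  (cusp_nbhd e i `&` side j) !=set0.
Proof.
move=> /andP[e0 e1].
(* The witnesses approach the ideal vertex along the side: at height e / 2 on a
   vertical side, at horizontal distance e / 2 on the circle, and high up for oo. *)
pose x := e / 2.
have x0 : 0 < x by rewrite /x; lra.
have sx : (Num.sqrt (x * (1 - x))) ^+ 2 = x * (1 - x).
  by rewrite sqr_sqrtr // mulr_ge0; rewrite /x; lra.
have sx0 : 0 < Num.sqrt (x * (1 - x)) by rewrite sqrtr_gt0 mulr_gt0 /x; lra.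
have V : e^-1 * e = 1 by rewrite mulVf // gt_eqF.
have V0 : 0 < e^-1 by rewrite invr_gt0.
have V2 : 1 <= e^-1 by nra.
have ex : x = e / 2 by [].
move: i j; apply: ord3P; apply: ord3P => // _.
- exists (1, x); split; (split; [apply/ideal_triP; split; [|apply: ord3P]|]);
    rewrite /form /cusp /wall /=; nra.
- exists (1 - x, Num.sqrt (x * (1 - x))).
  split; (split; [apply/ideal_triP; split; [|apply: ord3P]|]);
    rewrite /form /cusp /wall /= ?sx //; nra.
- exists (0, x); split; (split; [apply/ideal_triP; split; [|apply: ord3P]|]);
    rewrite /form /cusp /wall /=; nra.
- exists (x, Num.sqrt (x * (1 - x))).
  split; (split; [apply/ideal_triP; split; [|apply: ord3P]|]);
    rewrite /form /cusp /wall /= ?sx //; nra.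
- exists (0, e^-1 + 1).
  split; (split; [apply/ideal_triP; split; [|apply: ord3P]|]);
    rewrite /form /cusp /wall /=; nra.
- exists (1, e^-1 + 1).
  split; (split; [apply/ideal_triP; split; [|apply: ord3P]|]);
    rewrite /form /cusp /wall /=; nra.
Qed.

(** The closed conditions y >= 0 and those on walls and cusps already imply y > 0:
    the points with y = 0 left by the walls are 0 and 1, cut off by the cusps. *)
Lemma core_compact e : 0 < e -> compact (core e).
Proof.
move=> e0; have V : e^-1 * e = 1 by rewrite mulVf // gt_eqF.
have V0 : 0 < e^-1 by rewrite invr_gt0.
pose Q := [set z : plane R | 0 <= z.2] `&`
  (\bigcap_(i in [set: 'I_3]) [set z | 0 <= form (wall i) z] `&`
   \bigcap_(i in [set: 'I_3]) [set z | 0 <= form (cusp e i) z]).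
have closed_upper : closed [set z : plane R | 0 <= z.2].
  have c2 : continuous (fun z : plane R => z.2) by move=> p; exact: cvg_snd.
  move/continuous_closedP : c2 => /(_ [set x : R | 0 <= x]); apply.
  exact: closed_ge.
have coreQ : core e = Q.
  apply/seteqP; split=> z.
    by move=> [/ideal_triP[z0 hw] /= hc]; split; [exact: ltW|split=> i _ /=].
  move=> [/= z0 [hw hc]]; split; last by move=> i; exact: hc.
  apply/ideal_triP; split; last by move=> i; exact: hw.
  rewrite lt0r z0 andbT; apply/eqP => z20.
  have := hw 0 I; have := hw 1 I; have := hw 2%:R I.
  have := hc 0 I; have := hc 1 I; rewrite /form /wall /cusp /= z20 => *; nra.
pose B : set (plane R) := `[0 : R, 1]%classic `*` `[0 : R, e^-1 + 1]%classic.
rewrite coreQ; apply: (@subclosed_compact (plane R) Q B).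
- apply: closedI; first exact: closed_upper.
  by apply: closedI; apply: closed_bigI => i _; exact: closed_form_ge0.
- by apply: compact_setX; exact: segment_compact.
- move=> z [/= z0 [hw hc]]; have := hw 0 I; have := hw 1 I; have := hc 2%:R I.
  rewrite /form /wall /cusp /= => *; split; rewrite /= in_itv /=;
    apply/andP; split; nra.
Qed.

(** At e = 0 the forms l0 and l1 of the cusps at 1 and 0 are positive on the
    triangle, and l1 = s is unbounded at oo.  So the function m of the proof blows
    up exactly at the ideal vertices, and it is bounded on a compact set. *)
Lemma compact_sub_core (C : set (plane R)) : compact C -> C `<=` ideal_tri ->
  exists2 e, 0 < e <= 1 / 2 & C `<=` core e.
Proof.
move=> cC Ct.
pose l0 := @form R (cusp 0 0); pose l1 := @form R (cusp 0 1).
have l0p z : C z -> 0 < l0 z.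
  move=> /Ct/ideal_triP[z0 h]; have := h 0; have := h 1; have := h 2%:R.
  rewrite /l0 /form /wall /cusp /= => *; nra.
have l1p z : C z -> 0 < l1 z.
  move=> /Ct/ideal_triP[z0 h]; have := h 0; have := h 1; have := h 2%:R.
  rewrite /l1 /form /wall /cusp /= => *; nra.
pose m z := (l0 z)^-1 + (l1 z)^-1 + l1 z.
have cm : {within C, continuous m}.
  apply: continuous_in_subspaceT => z; rewrite inE => Cz.
  apply: cvgD; last exact: form_continuous.
  apply: cvgD; apply: cvgV; rewrite ?gt_eqF ?l0p ?l1p //;
    exact: form_continuous.
have [M [_ HM]] := compact_bounded (continuous_compact cm cC).
pose N := Num.max 2 (M + 1).
have N2 : 2 <= N by rewrite le_max lexx.
have mN z : C z -> m z <= N.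
  move=> Cz; have MN : M < N by rewrite lt_max ltrDl ltr01 orbT.
  apply: le_trans (HM _ MN (m z) _); first exact: ler_norm.
  by exists z.
have N0 : 0 < N by lra.
have NV : N^-1 * N = 1 by rewrite mulVf // gt_eqF.
have NV0 : 0 < N^-1 by rewrite invr_gt0.
exists N^-1; first by apply/andP; split => //; nra.
move=> z Cz; split; first exact: Ct.
have l0z := l0p _ Cz; have l1z := l1p _ Cz; have := mN _ Cz; rewrite /m => mz.
have v0 : (l0 z)^-1 * l0 z = 1 by rewrite mulVf // gt_eqF.
have v1 : (l1 z)^-1 * l1 z = 1 by rewrite mulVf // gt_eqF.
have w0 : 0 < (l0 z)^-1 by rewrite invr_gt0.
have w1 : 0 < (l1 z)^-1 by rewrite invr_gt0.
have e0 : N^-1 <= l0 z by nra.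
have e1 : N^-1 <= l1 z by nra.
have e2 : l1 z <= N by nra.
apply: ord3P.
- by move: e0; rewrite /l0 /form /cusp /= => e0; lra.
- by move: e1; rewrite /l1 /form /cusp /= => e1; lra.
- by move: e2; rewrite /l1 /form /cusp /= => e2; nra.
Qed.

End Cusps.

(** * Proper self-maps of the ideal triangle *)

Section ProperSelfMap.
Variables (R : realType) (U : plane R -> plane R).
Hypothesis U_cont : {within ideal_tri, continuous U}.
Hypothesis U_tri : U @` ideal_tri `<=` ideal_tri.
Hypothesis U_proper : proper_on ideal_tri ideal_tri U.
Hypothesis U_side : forall i, U @` side i `<=` side i.

Lemma notin_core (e : R) z : ideal_tri z -> ~ core e z ->
  exists i, cusp_nbhd e i z.
Proof.
move=> tz nz; apply: contrapT => h; apply: nz; split=> // i.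
by rewrite leNgt; apply/negP => zi; apply: h; exists i.
Qed.

(** Properness sends a small cusp into the union of the cusps and connectedness
    into one of them.  It meets the two sides adjacent to the first cusp, which U
    preserves, so it can only be the cusp at the same vertex. *)
Lemma cusp_preserved (e : R) : 0 < e <= 1 / 2 ->
  exists2 d, 0 < d <= e & forall i, U @` cusp_nbhd d i `<=` cusp_nbhd e i.
Proof.
move=> e01; have e0 : 0 < e by case/andP: e01.
have coreT (x : R) : core x `<=` ideal_tri by move=> z [].
have [| d' d'01 Ud'] := compact_sub_core (U_proper (core_compact e0) (@coreT e)).
  by move=> z [].
pose d := Num.min d' e.
have de : d <= e by rewrite ge_min lexx orbT.
have dd' : d <= d' by rewrite ge_min lexx.
have d0 : 0 < d by rewrite lt_min e0; case/andP: d'01 => ->.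
have d01 : 0 < d <= 1 / 2.
  by rewrite d0; apply: le_trans de _; case/andP: e01.
exists d; first by rewrite d0.
have Ud i z : cusp_nbhd d i z -> exists j, cusp_nbhd e j (U z).
  move=> zi; have tz : ideal_tri z by case: zi.
  apply: notin_core; first by apply: U_tri; exists z.
  move=> Uz; have [_ /= /(_ i)] := Ud' z (conj tz Uz).
  by rewrite leNgt => /negP; apply; have [] := cusp_nbhdS dd' zi.
move=> i; have [j ij] : exists j, U @` cusp_nbhd d i `<=` cusp_nbhd e j.
  have [|||||j Uj] := @connected_pigeonhole _ 'I_3
      (fun j => [set z : plane R | form (cusp e j) z < 0]) (U @` cusp_nbhd d i).
  - apply: connected_continuous_connected.
      apply: mix_convex_connected; last exact: mix_convex_form_lt0.
      by move=> z [/ideal_triP[/ltW]].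
    by apply: continuous_subspaceW U_cont => z [].
  - have [z [zi _]] := cusp_side_meet d01 (neq_lift i ord0).
    by exists (U z), z.
  - by left=> j; exact: open_form_lt0.
  - by move=> _ [z zi <-]; have [j [_ /= Uz]] := Ud _ _ zi; exists j.
  - move=> j k _ [z zi <-] /= Uj Uk.
    have tUz : ideal_tri (U z) by apply: U_tri; exists z => //; case: zi.
    by apply: (cusp_disjoint (z := U z) e01).
  - exists j => y [z zi yE]; split; last by apply: Uj; exists z.
    by apply: U_tri; exists z => //; case: zi.
have [E|ne] := eqVneq i j; first by rewrite -E in ij.
have [z [zi zj]] := cusp_side_meet d01 ne.
exfalso; apply: (cusp_side_disjoint e01 (i := j) (z := U z)).
  by apply: ij; exists z.
by apply: U_side; exists z.
Qed.

(** The homotopy from U to the identity is proper: a point near an ideal vertex and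
    its image both lie in the same cusp, which is convex. *)
Lemma mix_proper (C : set (plane R)) : compact C -> C `<=` ideal_tri ->
  exists Q : set (plane R), [/\ compact Q, Q `<=` ideal_tri &
    forall t z, 0 <= t <= 1 -> ideal_tri z -> C (mix t (U z) z) -> Q z].
Proof.
move=> cC Ct; have [e e01 Ce] := compact_sub_core cC Ct.
have [d /andP[d0 de] Ud] := cusp_preserved e01.
exists (core d); split; [exact: core_compact|by move=> z []|].
move=> t z t01 tz Cz; apply: contrapT => /(notin_core tz)[i zi].
have [_ /=] : cusp_nbhd e i (mix t (U z) z).
  apply: mix_convex_form_lt0 => //; first by apply: Ud; exists z.
  exact: (cusp_nbhdS de).
by have [_ /= /(_ i)] := Ce _ Cz; rewrite leNgt => /negP.
Qed.

End ProperSelfMap.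

(** * Arcs of the circle cut out by three points *)

Section CircleArcs.
Variable R : realType.
Implicit Types a b c p : plane R.

Definition nrm2 p : R := p.1 ^+ 2 + p.2 ^+ 2.

Definition cross a b p : R :=
  (b.1 - a.1) * (p.2 - a.2) - (b.2 - a.2) * (p.1 - a.1).

Lemma nrm2_gt0 a b : a != b -> 0 < nrm2 (a - b).
Proof.
move=> ab; rewrite lt0r addr_ge0 ?sqr_ge0 // andbT.
rewrite paddr_eq0 ?sqr_ge0 // !sqrf_eq0 /= !subr_eq0.
by apply: contraNN ab; case: a b => [x y] [x' y'] /= /andP[/eqP-> /eqP->].
Qed.

(** Three distinct points of a circle are not collinear.  With d = b - a and
    e = c - a, a vanishing determinant makes e the multiple k d of d, and
    |a + d| = |a + k d| = 1 forces k = 0 or k = 1. *)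
Lemma cross_neq0 a b c : nrm2 a = 1 -> nrm2 b = 1 -> nrm2 c = 1 ->
  a != b -> b != c -> c != a -> cross a b c != 0.
Proof.
move=> na nb nc /nrm2_gt0 ab /nrm2_gt0 bc /nrm2_gt0 ca; apply/eqP => z.
move: na nb nc ab bc ca z; rewrite /nrm2 /cross /=.
case: a b c => [x y] [x1 y1] [x2 y2] /= na nb nc ab bc ca z.
pose d1 := x1 - x; pose d2 := y1 - y; pose e1 := x2 - x; pose e2 := y2 - y.
have n0 : 0 < d1 ^+ 2 + d2 ^+ 2 by rewrite /d1 /d2; nra.
have q0 : 0 < e1 ^+ 2 + e2 ^+ 2 by rewrite /e1 /e2; nra.
have nq0 : 0 < (d1 - e1) ^+ 2 + (d2 - e2) ^+ 2 by rewrite /d1 /d2 /e1 /e2; nra.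
have h1 : x * d1 + y * d2 = - (d1 ^+ 2 + d2 ^+ 2) / 2 by rewrite /d1 /d2; nra.
have h2 : x * e1 + y * e2 = - (e1 ^+ 2 + e2 ^+ 2) / 2 by rewrite /e1 /e2; nra.
have z' : d1 * e2 = d2 * e1 by rewrite /d1 /d2 /e1 /e2; nra.
pose m := d1 * e1 + d2 * e2.
have k1 : (d1 ^+ 2 + d2 ^+ 2) * e1 = m * d1.
  by rewrite /m; transitivity (d1 ^+ 2 * e1 + d2 * (d2 * e1));
    [ring|rewrite -z'; ring].
have k2 : (d1 ^+ 2 + d2 ^+ 2) * e2 = m * d2.
  by rewrite /m; transitivity (d2 ^+ 2 * e2 + d1 * (d1 * e2));
    [ring|rewrite z'; ring].
have k : (d1 ^+ 2 + d2 ^+ 2) * (x * e1 + y * e2) = m * (x * d1 + y * d2).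
  transitivity (x * ((d1 ^+ 2 + d2 ^+ 2) * e1) + y * ((d1 ^+ 2 + d2 ^+ 2) * e2)).
    ring.
  by rewrite k1 k2; ring.
have l : (d1 ^+ 2 + d2 ^+ 2) * (e1 ^+ 2 + e2 ^+ 2) = m * m.
  transitivity (e1 * ((d1 ^+ 2 + d2 ^+ 2) * e1) + e2 * ((d1 ^+ 2 + d2 ^+ 2) * e2)).
    ring.
  by rewrite k1 k2 /m; ring.
have qm : e1 ^+ 2 + e2 ^+ 2 = m.
  apply: (mulfI (lt0r_neq0 n0)); move: k; rewrite h1 h2; lra.
have nm : d1 ^+ 2 + d2 ^+ 2 = m.
  by apply: (mulIf (lt0r_neq0 q0)); rewrite l qm.
move: nq0; rewrite (_ : _ + _ = (d1 ^+ 2 + d2 ^+ 2) + (e1 ^+ 2 + e2 ^+ 2) - 2 * m).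
  by rewrite nm qm; lra.
by rewrite /m; ring.
Qed.


Section Arcs.
Variables a b c : plane R.
Hypotheses (na : nrm2 a = 1) (nb : nrm2 b = 1) (nc : nrm2 c = 1).
Hypotheses (ab : a != b) (bc : b != c) (ca : c != a).

Let D := cross a b c.

Lemma cross_sum p : cross a b p + cross b c p + cross c a p = D.
Proof. by rewrite /D /cross; ring. Qed.

(** The cross products are D times the barycentric coordinates of p. *)
Lemma cross_barycenter p :
  D * p.1 = cross b c p * a.1 + cross c a p * b.1 + cross a b p * c.1 /\
  D * p.2 = cross b c p * a.2 + cross c a p * b.2 + cross a b p * c.2.
Proof. by rewrite /D /cross; split; ring. Qed.

(** The power D^2 (1 - |p|^2) of p with respect to the circle, expressed through
    barycentric coordinates, vanishes. *)
Lemma cross_power p : nrm2 p = 1 ->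
  cross b c p * cross c a p * nrm2 (a - b) +
  cross c a p * cross a b p * nrm2 (b - c) +
  cross a b p * cross b c p * nrm2 (c - a) = 0.
Proof.
move=> np; have [e1 e2] := cross_barycenter p; have eD := cross_sum p.
move: e1 e2 eD.
set s := cross b c p; set t := cross c a p; set u := cross a b p => e1 e2 eD.
transitivity (s * t * (nrm2 a + nrm2 b) + t * u * (nrm2 b + nrm2 c)
  + u * s * (nrm2 c + nrm2 a) + s ^+ 2 * nrm2 a + t ^+ 2 * nrm2 b
  + u ^+ 2 * nrm2 c - ((s * a.1 + t * b.1 + u * c.1) ^+ 2
  + (s * a.2 + t * b.2 + u * c.2) ^+ 2)).
  by rewrite /nrm2 /=; ring.
rewrite -e1 -e2 na nb nc.
transitivity ((u + s + t) ^+ 2 - D ^+ 2 * nrm2 p).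
  by rewrite /nrm2; ring.
by rewrite eD np; ring.
Qed.

(** A point in no arc has positive barycentric coordinates, so all terms of
    [cross_power] would be positive. *)
Lemma arc_cover p : nrm2 p = 1 ->
  [\/ Defs.arc a b c p, Defs.arc b c a p | Defs.arc c a b p].
Proof.
move=> np; have := cross_power np; have eD := cross_sum p.
have rot x y z : cross y z x = cross x y z by rewrite /cross; ring.
rewrite /Defs.arc /= -/(nrm2 p) -!/(cross _ _ _).
rewrite [cross b c a]rot [cross c a b]rot [cross b c a]rot -/D => pw.
have D0 : 0 < D ^+ 2 by rewrite exprn_even_gt0 //= cross_neq0.
have [h|h1] := leP (cross a b p * D) 0; first by constructor 1.
have [h|h2] := leP (cross b c p * D) 0; first by constructor 2.
have [h|h3] := leP (cross c a p * D) 0; first by constructor 3.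
have pos x y z : 0 < x * D -> 0 < y * D -> 0 < z -> 0 < x * y * z.
  move=> x0 y0 z0; rewrite pmulr_lgt0 // -(pmulr_lgt0 _ D0).
  have -> : x * y * D ^+ 2 = x * D * (y * D) by ring.
  exact: mulr_gt0.
have p1 := pos _ _ _ h2 h3 (nrm2_gt0 ab).
have p2 := pos _ _ _ h3 h1 (nrm2_gt0 bc).
have p3 := pos _ _ _ h1 h2 (nrm2_gt0 ca).
by exfalso; move: pw p1 p2 p3; lra.
Qed.

(** With D (p - b) = s (a - b) + u (c - b), the equation |p| = |b| gives the
    identity E in the proof, whose sides have opposite signs on both arcs. *)
Lemma arc_meet p : Defs.arc a b c p -> Defs.arc b c a p -> p = b.
Proof.
have rot x y z : cross y z x = cross x y z by rewrite /cross; ring.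
rewrite /Defs.arc /= -/(nrm2 p) -!/(cross _ _ _) => -[np hu] [_ hs].
rewrite [cross b c a]rot -/D in hs.
have [e1 e2] := cross_barycenter p; have eD := cross_sum p.
have D0 : D != 0 by rewrite cross_neq0.
move: e1 e2 eD hu hs.
set s := cross b c p; set t := cross c a p; set u := cross a b p.
rewrite -/D => e1 e2 eD hu hs.
have tE : t = D - u - s by rewrite -eD; ring.
have E : nrm2 (s *: (a - b) + u *: (c - b))
    = D * (s * nrm2 (a - b) + u * nrm2 (c - b)).
  transitivity ((s * a.1 + t * b.1 + u * c.1) ^+ 2
      + (s * a.2 + t * b.2 + u * c.2) ^+ 2 - D ^+ 2 * nrm2 b
      + D * (s * (nrm2 (a - b) + nrm2 b - nrm2 a)
             + u * (nrm2 (c - b) + nrm2 b - nrm2 c))).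
    by rewrite tE /nrm2 /= /GRing.scale /=; ring.
  rewrite -e1 -e2 na nb nc (_ : _ + (D * p.2) ^+ 2 = D ^+ 2 * nrm2 p).
    by rewrite np; ring.
  by rewrite /nrm2; ring.
have ge0 : 0 <= nrm2 (s *: (a - b) + u *: (c - b)).
  by rewrite addr_ge0 ?sqr_ge0.
have ab0 := nrm2_gt0 ab; have cb0 : 0 < nrm2 (c - b).
  by rewrite nrm2_gt0 // eq_sym.
have sD : s * D = 0.
  apply/eqP; rewrite eq_le hs /=; rewrite E in ge0; nra.
have uD : u * D = 0.
  apply/eqP; rewrite eq_le hu /=; rewrite E in ge0; nra.
have s0 : s = 0 by move/eqP: sD; rewrite mulf_eq0 (negbTE D0) orbF => /eqP.
have u0 : u = 0 by move/eqP: uD; rewrite mulf_eq0 (negbTE D0) orbF => /eqP.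
move: e1 e2; rewrite tE s0 u0 !mul0r !subr0 !add0r !addr0.
move=> /(mulfI D0) p1 /(mulfI D0) p2.
by rewrite (surjective_pairing p) p1 p2 -surjective_pairing.
Qed.

(** The witness is the second intersection of the circle with the line from c
    through the midpoint m of the chord ab; it lies beyond m since |m| < 1. *)
Lemma arc_inner_point : exists p,
  [/\ Defs.arc a b c p, p != a, p != b & p != c].
Proof.
have ab0 := nrm2_gt0 ab.
pose m := 2^-1 *: (a + b); pose d := m - c.
have nm : nrm2 m < 1.
  have : nrm2 m = (nrm2 a + nrm2 b) / 2 - nrm2 (a - b) / 4.
    by rewrite /nrm2 /m /= /GRing.scale /=; field.
  by rewrite na nb => ->; lra.
have n0 : 0 < nrm2 d.
  by rewrite nrm2_gt0 //; apply: contraTneq nm => ->; rewrite nc ltxx.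
pose k := - 2 * (c.1 * d.1 + c.2 * d.2).
pose t := k / nrm2 d.
have tn : t * nrm2 d = k by rewrite /t divfK // gt_eqF.
have kn : nrm2 d < k.
  have : nrm2 m = nrm2 c - k + nrm2 d by rewrite /k /d /nrm2 /=; ring.
  by rewrite nc; move: nm; lra.
have t1 : 1 < t by move: kn; rewrite -tn; nra.
have D0 : D != 0 by rewrite cross_neq0.
have cp : cross a b (c + t *: d) = (1 - t) * D.
  by rewrite /D /cross /d /m /= /GRing.scale /=; field.
have cp0 : cross a b (c + t *: d) != 0.
  by rewrite cp mulf_neq0 // subr_eq0 lt_eqF.
exists (c + t *: d); split.
- split.
    transitivity (nrm2 c + t * (t * nrm2 d - k)).
      by rewrite /nrm2 /k /= /GRing.scale /=; ring.
    by rewrite tn nc; ring.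
  change (cross a b (c + t *: d) * D <= 0).
  rewrite cp -mulrA mulr_le0_ge0 //; last by rewrite -expr2 sqr_ge0.
  by rewrite subr_le0 ltW.
- by apply: contraNneq cp0 => ->; rewrite /cross; apply/eqP; ring.
- by apply: contraNneq cp0 => ->; rewrite /cross; apply/eqP; ring.
- apply/eqP => pc; have td : t *: d = 0.
    by apply: (addrI c); rewrite pc addr0.
  move: n0; have t0 : t != 0 by rewrite gt_eqF //; lra.
  move/eqP: td; rewrite scaler_eq0 (negbTE t0) /= => /eqP ->.
  by rewrite /nrm2 /= expr0n addr0 ltxx.
Qed.

End Arcs.

Lemma closed_arc a b c : closed (Defs.arc a b c).
Proof.
have c1 : continuous (fun x : plane R => x.1) by move=> p; exact: cvg_fst.
have c2 : continuous (fun x : plane R => x.2) by move=> p; exact: cvg_snd.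
have ck (k : R) : continuous (fun _ : plane R => k) by move=> p; exact: cvg_cst.
have -> : Defs.arc a b c = [set p | nrm2 p = 1] `&`
    [set p | cross a b p * cross a b c <= 0] by [].
apply: closedI.
  have /continuous_closedP : continuous nrm2.
    by apply: continuous_add; apply: continuous_sqr.
  by move=> /(_ [set x : R | x = 1]); apply; exact: closed_eq.
have /continuous_closedP : continuous (fun p => cross a b p * cross a b c).
  apply: continuous_mul => //; apply: continuous_add.
    by apply: continuous_mul => //; apply: continuous_add.
  have -> : (fun x : plane R => - ((b.2 - a.2) * (x.1 - a.1))) =
      (fun x => (a.2 - b.2) * (x.1 - a.1)) by apply/funext => x; ring.
  by apply: continuous_mul => //; apply: continuous_add.
by move=> /(_ [set x : R | x <= 0]); apply; exact: closed_le.
Qed.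

End CircleArcs.

(** * Diffeomorphisms preserve boundary points *)

Section CriticalPoints.
Variable R : realType.

Lemma derive_min_ge0 (V : normedModType R) (f : V -> R) (a v : V) :
  (\forall x \near a, f a <= f x) -> derivable f a v -> 0 <= 'D_v f a.
Proof.
move=> fmin df; rewrite leNgt; apply/negP => L0.
have near_lt : \forall h \near 0^',
    h^-1 *: ((f \o shift a) (h *: v) - f a) < 0.
  by apply: (cvgr_lt _ df).
have near_ge : \forall h \near (0 : R), f a <= f (h *: v + a).
  apply: (@near0Z _ _ v [set y | f a <= f (y + a)]).
  by rewrite (near_shift a) /=; near do rewrite /= sub0r addrNK.
have near_ge' : \forall h \near 0^', f a <= f (h *: v + a).
  by apply: (@filterS _ (nbhs (0 : R)) _ _ _ _ near_ge) => h fh _.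
have : \forall h \near 0^',
    h^-1 *: ((f \o shift a) (h *: v) - f a) < 0 /\ f a <= f (h *: v + a).
  by near=> h; split; near: h.
move=> [e /= e0 He].
have e20 : 0 < e / 2 by rewrite divr_gt0.
have [||h1 h2] := He (e / 2).
- by rewrite /ball_ /= sub0r normrN gtr0_norm // ltr_pdivrMr // ltr_pMr // ltr1n.
- by rewrite gt_eqF.
move: h1; rewrite /= /shift; apply/negP; rewrite -leNgt.
by rewrite mulr_ge0 // ?invr_ge0 ?subr_ge0 // ltW.
Unshelve. all: by end_near. Qed.

Lemma diff_min (V : normedModType R) (f : V -> R) (a v : V) :
  differentiable f a -> (\forall x \near a, f a <= f x) -> 'd f a v = 0.
Proof.
move=> df fmin; have ge0 w : 0 <= 'd f a w.
  by rewrite -deriveE //; apply: derive_min_ge0 => //; exact: diff_derivable.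
by apply/eqP; rewrite eq_le ge0 andbT -oppr_ge0 -linearN ge0.
Qed.

(** A left invertible endomorphism of the plane is onto.  The adjugate matrix of G
    makes this explicit: D e1 and D e2 are in its image, D its determinant. *)
Lemma plane_left_inverse_annihilator (G F : {linear plane R -> plane R})
    (r : {linear plane R -> R}) :
  (forall v, F (G v) = v) -> (forall v, r (G v) = 0) -> forall v, r v = 0.
Proof.
move=> FG rG.
pose e1 : plane R := (1, 0); pose e2 : plane R := (0, 1).
have dec (v : plane R) : v = v.1 *: e1 + v.2 *: e2.
  case: v => x y; congr (_, _); rewrite /= /GRing.scale /=; ring.
pose m11 := (G e1).1; pose m21 := (G e1).2.
pose m12 := (G e2).1; pose m22 := (G e2).2.
pose D := m11 * m22 - m12 * m21.
have E1 : D *: e1 = m22 *: G e1 - m21 *: G e2.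
  by rewrite [G e1]surjective_pairing [G e2]surjective_pairing;
    congr (_, _); rewrite /D /m11 /m12 /m21 /m22 /= /GRing.scale /=; ring.
have E2 : D *: e2 = m11 *: G e2 - m12 *: G e1.
  by rewrite [G e1]surjective_pairing [G e2]surjective_pairing;
    congr (_, _); rewrite /D /m11 /m12 /m21 /m22 /= /GRing.scale /=; ring.
have D0 : D != 0.
  have free (x y : R) : 0 = x *: e1 - y *: e2 -> x = 0 /\ y = 0.
    have -> : x *: e1 - y *: e2 = (x, - y).
      by congr (_, _); rewrite /= /GRing.scale /=; ring.
    by move=> -[<- y0]; split => //; rewrite -[y]opprK -y0 oppr0.
  have FZ (k : R) (w : plane R) : F (k *: G w) = k *: w.
    by rewrite linearZ /= FG.
  apply/eqP => D0; move: E1 E2; rewrite D0 !scale0r.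
  move=> /(congr1 F); rewrite linear0 linearB !FZ => E1.
  have [m220 m210] : m22 = 0 /\ m21 = 0 by exact: free.
  move=> /(congr1 F); rewrite linear0 linearB !FZ => E2.
  have [m120 m110] : m12 = 0 /\ m11 = 0.
    by apply: free; rewrite -oppr0 E2 opprB.
  have : G e1 = 0 by rewrite [G e1]surjective_pairing -/m11 -/m21 m110 m210.
  move=> /(congr1 F); rewrite FG linear0 => -[] /eqP.
  by rewrite oner_eq0.
have rD v : r (D *: v) = 0 -> r v = 0.
  by rewrite linearZ => /eqP; rewrite mulf_eq0 (negbTE D0) => /eqP.
have rZ (k : R) w : r w = 0 -> r (k *: w) = 0.
  by move=> rw; rewrite linearZ /= rw; exact: mulr0.
have r1 : r e1 = 0 by apply: rD; rewrite E1 linearB !rZ ?subrr.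
have r2 : r e2 = 0 by apply: rD; rewrite E2 linearB !rZ ?subrr.
by move=> v; rewrite (dec v) linearD !rZ // addr0.
Qed.

Lemma smooth_on_within_continuous (A : set (plane R)) (f : plane R -> plane R) :
  smooth_on A f -> {within A, continuous f}.
Proof.
move=> sf; apply/subspace_continuousP => p Ap.
have [U [g [oU Up sg fg]]] := sf p Ap.
have cg : g @ within A (nbhs p) --> g p.
  apply: cvg_trans (sg 0%N p Up); apply: cvg_app; exact: cvg_within.
have fgE q : A q -> U q -> g q = f q by move=> Aq Uq; rewrite fg // inE.
change (f @ within A (nbhs p) --> f p).
rewrite -(fgE p Ap Up); apply: cvg_trans cg.
apply: near_eq_cvg; rewrite /within /=.
have nU : nbhs p U by exact: open_nbhs_nbhs.
by apply: filterS nU => q Uq Aq; exact: fgE.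
Qed.

(** If a point of A corresponds to an interior point q of B, then rho \o g has a
    minimum at q, so its differential vanishes there; the differential of g at q
    is invertible because a smooth extension of f inverts g near q.  Applied to
    functions rho defining the boundary, whose differentials do not vanish, this
    shows that boundary points cannot correspond to interior points, without
    invariance of domain. *)
Lemma diffeo_interior_critical (A B : set (plane R))
    (f g : plane R -> plane R) (rho : plane R -> R) (q : plane R) :
  diffeo_pair A B f g -> nbhs q B -> (forall z, A z -> 0 <= rho z) ->
  rho (g q) = 0 -> differentiable rho (g q) -> forall v, 'd rho (g q) v = 0.
Proof.
move=> [[fAB gBA fK gK] [sf sg]] nB rho0 rhoq drho.
have Bq := nbhs_singleton nB.
have Aq : A (g q) by apply: gBA; exists q.
have [U [G [oU Uq sG gG]]] := sg q Bq.
have [W [F [oW Wq sF fF]]] := sf _ Aq.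
have GE x : B x -> U x -> G x = g x.
  by move=> Bx Ux; rewrite gG // inE.
have Gq : G q = g q by exact: GE.
have nU : nbhs q U by exact: open_nbhs_nbhs.
have dG : differentiable G q by case: (sG 1%N) => + _; apply.
have dF : differentiable F (G q) by rewrite Gq; case: (sF 1%N) => + _; apply.
have nW : nbhs q (G @^-1` W).
  apply: (differentiable_continuous dG); rewrite Gq; exact: open_nbhs_nbhs.
rewrite -Gq in drho *.
apply: (@plane_left_inverse_annihilator ('d G q) ('d F (G q))) => v.
- rewrite -[LHS]/(('d F (G q) \o 'd G q) v) -diff_comp //.
  rewrite -deriveE; last exact: differentiable_comp.
  rewrite -[RHS](derive_id q v); apply: near_eq_derive.
  apply: filterS3 nB nU nW => x Bx Ux /= Wx.
  rewrite GE //= in Wx *; have Agx : A (g x) by apply: gBA; exists x.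
  by rewrite -fF ?inE // gK // inE.
- rewrite -[LHS]/(('d rho (G q) \o 'd G q) v) -diff_comp //.
  apply: diff_min; first exact: differentiable_comp.
  apply: filterS2 nB nU => x Bx Ux /=.
  by rewrite Gq rhoq GE //; apply: rho0; apply: gBA; exists x.
Qed.

End CriticalPoints.

(** * Sides of a face and sides of the ideal triangle *)

Lemma form_diff (R : realType) (c : R * R * R) (z : plane R) :
  is_diff z (form c) (fun v => c.1.2 * v.1 + 2 * c.2 * (z.1 * v.1 + z.2 * v.2)).
Proof.
have d1 : is_diff z (fst : plane R -> R) (fst : plane R -> R).
  apply: DiffDef.
    by apply: linear_differentiable => x; exact: cvg_fst.
  by rewrite diff_lin // => x; exact: cvg_fst.
have d2 : is_diff z (snd : plane R -> R) (snd : plane R -> R).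
  apply: DiffDef.
    by apply: linear_differentiable => x; exact: cvg_snd.
  by rewrite diff_lin // => x; exact: cvg_snd.
have -> : form c = cst c.1.1 + c.1.2 *: (fst : plane R -> R)
    + c.2 *: ((fst : plane R -> R) ^+ 2 + (snd : plane R -> R) ^+ 2).
  by apply/funext.
have q1 := is_diffX 1 d1; have q2 := is_diffX 1 d2.
apply: (is_diff_eq (is_diffD (is_diffD (is_diff_cst _ _) (is_diffZ c.1.2 d1))
  (is_diffZ c.2 (is_diffD q1 q2)))).
apply/funext => w; rewrite !fctE.
rewrite (_ : (0 : plane R -> R) w = 0) // /GRing.scale /=; ring.
Qed.

Lemma surj_ord_inj (n : nat) (s : 'I_n -> 'I_n) :
  (forall j, exists i, s i = j) -> injective s.
Proof.
move=> /choice[g gK].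
have [h gh hg] := injF_bij (can_inj gK).
by apply: (can_inj (g := g)) => i; rewrite -[in LHS](hg i) gK hg.
Qed.

Section ChartSides.
Variables (R : realType) (K : triangulation R) (T : tri K).

Let v := @vtx R K T.

Lemma diffeo_pair_sym (A B : set (plane R)) (f g : plane R -> plane R) :
  diffeo_pair A B f g -> diffeo_pair B A g f.
Proof. by move=> [[fA gB fK gK] [sf sg]]. Qed.

Lemma face_interior (p : plane R) : nrm2 p < 1 -> nbhs p (face T).
Proof.
move=> p1; have : nbhs p [set q : plane R | form (- 1, 0, 1) q < 0].
  apply: open_nbhs_nbhs; split; first exact: open_form_lt0.
  by move: p1; rewrite /nrm2 /form /=; lra.
apply: filterS => q; rewrite /form /= => hq; split; first by rewrite /disc /=; lra.
by move=> [i _ vi]; have := vtx_circle T i; rewrite vi; lra.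
Qed.

Lemma ideal_tri_interior (z : plane R) :
  0 < z.2 -> (forall i, 0 < form (wall i) z) -> nbhs z ideal_tri.
Proof.
move=> z0 zi.
have np (c : R * R * R) : 0 < form c z -> nbhs z [set q | 0 < form c q].
  by move=> cz; exact: (form_continuous (lt_nbhsr cz)).
have n2 : nbhs z [set q : plane R | 0 < q.2].
  have c2 : {for z, continuous (fun q : plane R => q.2)} by exact: cvg_snd.
  exact: (c2 _ (lt_nbhsr z0)).
near=> q; apply/ideal_triP; split; first by near: q.
by apply: ord3P; apply: ltW; near: q; exact: np.
Unshelve. all: by end_near. Qed.

Lemma boundary_chart (f g : plane R -> plane R) p :
  diffeo_pair (face T) ideal_tri f g -> face_boundary T p ->
  exists i, side i (f p).
Proof.
move=> fg [Fp p1]; have [[fA gB fK gK] _] := fg.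
have tfp : ideal_tri (f p) by apply: fA; exists p.
have gfp : g (f p) = p by rewrite fK ?inE.
apply: contrapT => nside.
have df := @form_diff R (1, 0, -1) (g (f p)).
have key w : 'd (form (1, 0, -1)) (g (f p)) w = 0.
  apply: (diffeo_interior_critical fg) => //.
  - have /ideal_triP[z0 h] := tfp; apply: ideal_tri_interior => // i.
    rewrite lt0r h andbT; apply/eqP => hi; apply: nside; exists i; split=> //.
  - by move=> z [zd _]; move: zd; rewrite /disc /form /=; lra.
  - by rewrite gfp /form /=; lra.
have := key p; rewrite diff_val gfp /=; lra.
Qed.

Lemma boundary_cochart (f g : plane R -> plane R) i z :
  diffeo_pair (face T) ideal_tri f g -> side i z -> face_boundary T (g z).
Proof.
move=> fg [tz /= zi]; have [[fA gB fK gK] _] := fg.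
have Fgz : face T (g z) by apply: gB; exists z.
have fgz : f (g z) = z by rewrite gK ?inE.
split=> //; apply: contrapT => n1.
have key w : 'd (form (wall i)) (f (g z)) w = 0.
  apply: (diffeo_interior_critical (diffeo_pair_sym fg)) => //.
  - apply: face_interior; case: Fgz => + _; rewrite /disc /= /nrm2 => le1.
    by rewrite lt_neqAle le1 andbT; apply/eqP.
  - by move=> x /ideal_triP[_].
  - by rewrite fgz.
  - exact: (ex_diff (is_diff_def := form_diff (wall i) (f (g z)))).
have df := @form_diff R (wall i) (f (g z)).
have := key (1, 0); have := key (0, 1); rewrite diff_val fgz /=.
have /ideal_triP[z0 _] := tz; move: i {zi key df}; apply: ord3P;
  rewrite /wall /=; lra.
Qed.

Lemma oedge_boundary i p : oedge (T, i) p -> face_boundary T p.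
Proof. by move=> [[p1 _] Fp]. Qed.

Lemma vtx_neq i j : i != j -> v i != v j.
Proof. by apply: contraNneq => /vtx_inj ->. Qed.

Let ordE (i : 'I_3) : (i + 1 != i) && (i + 2%:R != i) && (i + 1 != i + 2%:R).
Proof. by move: i; apply: ord3P. Qed.

Let edgeE i : edge (T, i) = Defs.arc (v (i + 1)) (v (i + 2%:R)) (v i).
Proof. by []. Qed.

Let vtx_nrm2 i : nrm2 (v i) = 1. Proof. exact: vtx_circle. Qed.

Let e12 : (1 + 1 : 'I_3) = 2%:R. Proof. exact/val_inj. Qed.
Let e13 : (1 + 2%:R : 'I_3) = 0. Proof. exact/val_inj. Qed.
Let e22 : (2%:R + 1 : 'I_3) = 0. Proof. exact/val_inj. Qed.
Let e23 : (2%:R + 2%:R : 'I_3) = 1. Proof. exact/val_inj. Qed.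

Let n01 : v 0 != v 1. Proof. exact: vtx_neq. Qed.
Let n12 : v 1 != v 2%:R. Proof. exact: vtx_neq. Qed.
Let n20 : v 2%:R != v 0. Proof. exact: vtx_neq. Qed.

Let edge0 : edge (T, 0) = Defs.arc (v 1) (v 2%:R) (v 0).
Proof. by rewrite edgeE !add0r. Qed.
Let edge1 : edge (T, 1) = Defs.arc (v 2%:R) (v 0) (v 1).
Proof. by rewrite edgeE e12 e13. Qed.
Let edge2 : edge (T, 2%:R) = Defs.arc (v 0) (v 1) (v 2%:R).
Proof. by rewrite edgeE e22 e23. Qed.

Lemma boundary_oedge p : face_boundary T p -> exists i, oedge (T, i) p.
Proof.
move=> [Fp p1].
have [] := arc_cover (vtx_nrm2 0) (vtx_nrm2 1) (vtx_nrm2 2%:R) n01 n12 n20 p1.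
- by rewrite -edge2; exists 2%:R.
- by rewrite -edge0; exists 0.
- by rewrite -edge1; exists 1.
Qed.

Lemma oedge_disjoint i j p : oedge (T, i) p -> oedge (T, j) p -> i = j.
Proof.
have m01 : edge (T, 0) p -> edge (T, 1) p -> p = v 2%:R.
  rewrite edge0 edge1; exact: arc_meet.
have m12 : edge (T, 1) p -> edge (T, 2%:R) p -> p = v 0.
  rewrite edge1 edge2; exact: arc_meet.
have m20 : edge (T, 2%:R) p -> edge (T, 0) p -> p = v 1.
  rewrite edge2 edge0; exact: arc_meet.
move=> [hi [_ nv]] [hj _]; have nvE k : p <> v k.
  by move=> pk; apply: nv; exists k.
move: i j {nv} hi hj; apply: ord3P; apply: ord3P => // hi hj; exfalso.
- exact: nvE (m01 hi hj).
- exact: nvE (m20 hj hi).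
- exact: nvE (m01 hj hi).
- exact: nvE (m12 hi hj).
- exact: nvE (m20 hi hj).
- exact: nvE (m12 hj hi).
Qed.

Lemma oedge_nonempty i : oedge (T, i) !=set0.
Proof.
have [/andP[a b] c] := andP (ordE i).
have nv1 : v (i + 1) != v (i + 2%:R) by exact: vtx_neq.
have nv2 : v (i + 2%:R) != v i by exact: vtx_neq.
have nv3 : v i != v (i + 1) by rewrite eq_sym; exact: vtx_neq.
have [p [pa p1 p2 p3]] := arc_inner_point (vtx_nrm2 _) (vtx_nrm2 _)
  (vtx_nrm2 i) nv1 nv2 nv3.
exists p; split=> //; split; first by case: pa => + _; rewrite /disc /= => ->.
move=> [k _ kp].
have : [|| k == i + 1, k == i + 2%:R | k == i].
  by move: {+}k {+}i; apply: ord3P; apply: ord3P.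
by case/or3P => /eqP ki; move: p1 p2 p3; rewrite -kp ki eqxx.
Qed.

Lemma closed_edge i : closed (edge (T, i)).
Proof. exact: closed_arc. Qed.

(** By connectedness a chart matches each side of the ideal triangle with an arc;
    the arcs being nonempty, the matching is onto, hence injective.  A map that
    preserves the arcs therefore preserves the sides once read in the chart. *)
Lemma chart_conj_side (f ch co : plane R -> plane R) :
  diffeo_pair (face T) ideal_tri ch co ->
  (forall i, f @` oedge (T, i) `<=` oedge (T, i)) ->
  forall i, (ch \o f \o co) @` side i `<=` side i.
Proof.
move=> chco fe; have [[chA coB chK coK] [_ /smooth_on_within_continuous cco]] := chco.
have tri_side i z : @side R i z -> ideal_tri z by case.
have /choice[s sP] : forall i : 'I_3, exists j, co @` side i `<=` oedge (T, j).
  move=> i; have [|||||j hj] := @connected_pigeonhole _ 'I_3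
      (fun j => edge (T, j)) (co @` side i).
  - apply: connected_continuous_connected.
      apply: mix_convex_connected; last exact: mix_convex_form_eq0.
      by move=> z [/ideal_triP[/ltW]].
    by apply: continuous_subspaceW cco; exact: tri_side.
  - have h2 : 0 < (1 / 2 : R) <= 1 / 2 by apply/andP; split; lra.
    have ne : lift i ord0 != i by rewrite eq_sym neq_lift.
    have [z [_ zi]] := cusp_side_meet h2 ne.
    by exists (co z), z.
  - by right=> j; exact: closed_edge.
  - move=> _ [z zi <-]; have /boundary_oedge[j [h _]] := boundary_cochart chco zi.
    by exists j.
  - move=> j k _ [z zi <-] hj hk; have [Fz _] := boundary_cochart chco zi.
    exact: (@oedge_disjoint _ _ (co z)).
  - exists j => _ [z zi <-]; split; first by apply: hj; exists z.
    by have [] := boundary_cochart chco zi.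
have sinj : injective s.
  apply: surj_ord_inj => j; have [p pj] := oedge_nonempty j.
  have [i hi] := boundary_chart chco (oedge_boundary pj).
  have Fp : face T p by case: pj.
  exists i; apply: oedge_disjoint pj; apply: (sP i).
  by exists (ch p) => //; rewrite chK ?inE.
move=> i _ [z zi <-] /=.
have fz : oedge (T, s i) (f (co z)).
  by apply: fe; exists (co z) => //; apply: (sP i); exists z.
have [k hk] := boundary_chart chco (oedge_boundary fz).
have Ff : face T (f (co z)) by case: fz.
suff -> : i = k by [].
apply: sinj; apply: oedge_disjoint fz _; apply: (sP k).
by exists (ch (f (co z))) => //; rewrite chK ?inE.
Qed.

End ChartSides.

(** * The degree of a proper map preserving the edges *)

Lemma unit_intervalP (R : realType) (t : R) :
  unit_interval t <-> 0 <= t <= 1.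
Proof. by rewrite /unit_interval /= in_itv. Qed.

Section Degree.
Variables (R : realType) (K : triangulation R) (T : tri K).

Lemma proper_conj (A B : set (plane R)) (f ch co : plane R -> plane R) :
  diffeo_pair A B ch co -> proper_on A A f -> f @` A `<=` A ->
  proper_on B B (ch \o f \o co).
Proof.
move=> [[chA coB chK coK] [sch sco]] pf fA C cC CB.
have ccoC : compact (co @` C).
  apply: continuous_compact cC; apply: continuous_subspaceW CB _.
  exact: smooth_on_within_continuous.
have coCA : co @` C `<=` A by move=> _ [z Cz <-]; apply: coB; exists z => //; exact: CB.
have cP := pf _ ccoC coCA.
rewrite (_ : [set z | _] = ch @` [set p | A p /\ (co @` C) (f p)]).
  apply: continuous_compact cP.
  apply: continuous_subspaceW (smooth_on_within_continuous sch).
  by move=> p [].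
apply/seteqP; split=> [z [Bz /= Cz]|_ [p [Ap /= [z Cz zp]] <-]] /=.
  have Az : A (co z) by apply: coB; exists z.
  exists (co z); last by rewrite coK ?inE.
  split=> //; exists (ch (f (co z))) => //.
  by rewrite chK ?inE //; apply: fA; exists (co z).
have Bp : B (ch p) by apply: chA; exists p.
by split=> //; rewrite chK ?inE // -zp coK ?inE //; exact: CB.
Qed.

(** Read in the chart, the homotopy is the straight one of the coordinates in which
    the ideal triangle is convex.  It preserves each side, sides being convex. *)
Lemma proper_homotopic_id (f ch co : plane R -> plane R) :
  diffeo_pair (face T) ideal_tri ch co ->
  f @` face T `<=` face T ->
  (forall i, f @` oedge (T, i) `<=` oedge (T, i)) ->
  {within face T, continuous f} -> proper_on (face T) (face T) f ->
  proper_homotopic T f id.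
Proof.
move=> chco fF fe cf pf; have := chart_conj_side chco fe.
have := proper_conj chco pf fF.
have [[chA coB chK coK] [sch sco]] := chco.
have cch := smooth_on_within_continuous sch.
have cco := smooth_on_within_continuous sco.
set U := ch \o f \o co => pU Uside.
have UE p : face T p -> U (ch p) = ch (f p).
  by move=> Fp; rewrite /U /= chK ?inE.
have Ff p : face T p -> face T (f p) by move=> Fp; apply: fF; exists p.
have tch p : face T p -> ideal_tri (ch p) by move=> Fp; apply: chA; exists p.
have Fco z : ideal_tri z -> face T (co z) by move=> tz; apply: coB; exists z.
have Utri : U @` ideal_tri `<=` ideal_tri.
  by move=> _ [z tz <-]; apply: tch; apply: Ff; exact: Fco.
have cU : {within ideal_tri, continuous U}.
  apply: (within_continuous_comp (B := face T)) cch _.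
    apply: (within_continuous_comp (B := face T)) cco cf _.
    by move=> _ [z tz <-]; exact: Fco.
  by move=> _ [z tz <-]; apply: Ff; exact: Fco.
pose D := @unit_interval R `*` face T.
pose H (x : R * plane R) := mix x.1 (ch (f x.2)) (ch x.2).
have HT x : D x -> ideal_tri (H x).
  move=> [t01 Fp]; apply: mix_convex_ideal_tri; first exact/unit_intervalP.
    exact/tch/Ff.
  exact: tch.
have cH : {within D, continuous H}.
  have c1 : {within D, continuous (fun x : R * plane R => x.1)}.
    by apply: continuous_subspaceT => x; exact: cvg_fst.
  have c2 : {within D, continuous (fun x : R * plane R => x.2)}.
    by apply: continuous_subspaceT => x; exact: cvg_snd.
  have DF : snd @` D `<=` face T by move=> _ [x [_ Fx] <-].
  have c2c := within_continuous_comp c2 cch DF.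
  have c2f := within_continuous_comp c2 cf DF.
  have c2fc : {within D, continuous (ch \o (f \o snd))}.
    apply: within_continuous_comp c2f cch _.
    by move=> _ [x [_ Fx] <-]; exact: Ff.
  have cm : {within setT, continuous (fun x : R * (plane R * plane R) =>
      mix x.1 x.2.1 x.2.2)}.
    by apply: continuous_subspaceT; exact: mix_continuous.
  have c12 := within_continuous_pair c1 (within_continuous_pair c2fc c2c).
  by apply: (within_continuous_comp c12 cm).
have ch01 : {within D, continuous (co \o H)}.
  apply: within_continuous_comp cH cco _.
  by move=> _ [x Dx <-]; exact: HT.
exists (co \o H); split.
- exact: ch01.
- by move=> t p t01 Fp; apply/Fco/HT; split=> //=; exact/unit_intervalP.
- move=> t p t01 bp; have Fp : face T p by case: bp.
  have [i hi] := boundary_chart chco bp.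
  apply: (boundary_cochart (i := i) chco).
  apply: mix_convex_form_eq0 => //=.
  by rewrite -UE //; apply: Uside; exists (ch p).
- move=> p Fp; have t1 := tch _ Fp; have t2 := tch _ (Ff _ Fp).
  rewrite /H /= mix0; last by case/ideal_triP: t2 => /ltW.
  rewrite mix1; last by case/ideal_triP: t1 => /ltW.
  by rewrite !chK ?inE //; exact: Ff.
- move=> C cC CF.
  have cchC : compact (ch @` C).
    by apply: continuous_compact cC; exact: continuous_subspaceW CF cch.
  have chCt : ch @` C `<=` ideal_tri.
    by move=> _ [p Cp <-]; apply: tch; exact: CF.
  have [Q [cQ Qt QP]] := mix_proper cU Utri pU Uside cchC chCt.
  pose E := [set t : R | 0 <= t <= 1] `*` (co @` Q).
  have ED : E `<=` D.
    move=> x [x1 [z Qz zx]]; split; first exact/unit_intervalP.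
    by rewrite -zx; apply/Fco/Qt.
  have cE : compact E.
    apply: compact_setX.
      have -> : [set t : R | 0 <= t <= 1] = unit_interval.
        by apply/seteqP; split=> t /unit_intervalP.
      exact: segment_compact.
    by apply: continuous_compact cQ; exact: continuous_subspaceW Qt cco.
  have clC : closed C by apply: compact_closed cC; exact: norm_hausdorff.
  have := compact_within_preimage cE (continuous_subspaceW ED ch01) clC.
  congr (compact _); apply/seteqP; split=> [x [Ex Cx]|x [Dx Cx]].
    by split=> //; exact: ED.
  split=> //; have [x1 Fx] := Dx; split; first exact/unit_intervalP.
  exists (ch x.2); last by rewrite chK ?inE.
  apply: (QP x.1); first exact/unit_intervalP.
    exact: tch.
  exists (co (H x)); first exact: Cx.
  rewrite coK ?inE; last exact: HT.
  by rewrite /H UE.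
Qed.

Lemma smooth_open_cst (V : normedModType R) (U : set (plane R)) (a : V) :
  smooth_open U (fun _ => a).
Proof.
move=> n; elim: n a => [|n IH] a /=; first by move=> z _; exact: cst_continuous.
split; first by move=> z _; exact: differentiable_cst.
move=> w; rewrite (_ : (fun z : plane R => 'D_w (fun _ => a) z) = fun _ => 0);
  first exact: (IH 0).
by apply/funext => z; exact: derive_cst.
Qed.

Lemma smooth_on_id (A : set (plane R)) : smooth_on A id.
Proof.
move=> p Ap; exists setT, id; split=> //; first exact: openT.
case=> [|n] /=; first by move=> z _; exact: cvg_id.
split; first by move=> z _; exact: ex_diff.
move=> w; rewrite (_ : (fun z : plane R => 'D_w id z) = fun _ => w).
  exact: smooth_open_cst.
by apply/funext => z; exact: derive_id.
Qed.

Lemma degree_id (f : plane R -> plane R) :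
  proper_homotopic T f id -> has_degree T f 1.
Proof.
move=> fid; exists id, (0, 0), [:: (0, 0)].
have F0 : face T (0, 0).
  apply: nbhs_singleton; apply: face_interior.
  by rewrite /nrm2 /= expr0n addr0 ltr01.
have J p : jacobian_det (id : plane R -> plane R) p = 1.
  by rewrite /jacobian_det /basis /= !derive_id /= mulr1 mulr0 subr0.
split=> //; first exact: smooth_on_id.
  by split=> // -[_ /=]; rewrite expr0n addr0 => /eqP; rewrite eq_sym oner_eq0.
split=> //.
- by move=> x; rewrite inE; split=> [/eqP->|[_ ->]].
- by move=> x _; rewrite J oner_eq0.
- by rewrite big_seq1 J sgz1.
Qed.

End Degree.

(** A chart of t transports the convex structure of the ideal triangle to T. *)
Lemma simplicial_proper_degree (R : realType) (K : triangulation R)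
    (t : ideal_metric K) (u : smap K) (T : tri K) :
  simplicial u -> {within face T, continuous (u T)} ->
  proper_on (face T) (face T) (u T) -> has_degree T (u T) 1.
Proof.
move=> [uF ue _] cu pu; apply: degree_id.
by apply: (proper_homotopic_id (chart_diffeo t T)) => // i; exact: (ue (T, i)).
Qed.

Theorem theorem35 (R : realType) (K : triangulation R)
  (hK : path_connected K)
  (sigma tau : ideal_metric K)
  (hsigma : complete_metric sigma) (htau : complete_metric tau)
  (u uD : smap K)
  (hu : constructed_minimizer sigma tau false u)
  (huD : constructed_minimizer sigma tau true uD)
  (proper_u : forall T : tri K, proper_on (face T) (face T) (u T))
  (proper_uD : forall T : tri K, proper_on (face T) (face T) (uD T)) :
  (forall T : tri K, has_degree T (u T) 1%R) /\
  (forall T : tri K, has_degree T (uD T) 1%R).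
Proof.
have deg diff x : constructed_minimizer sigma tau diff x ->
    (forall T, proper_on (face T) (face T) (x T)) ->
    forall T, has_degree T (x T) 1.
  move=> [w [v [X [X' [m [j min]]]]]] px T.
  apply: (simplicial_proper_degree tau) => //.
    by have [[]] := u_closure min.
  exact: (u_continuous min).
by split; [exact: deg hu proper_u|exact: deg huD proper_uD].
Qed.
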